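(* Let $N\in\mathbb N$ and let $\Omega=\Omega^{(L)}\cup\Omega^{(R)}$ be a planar two-patch domain described by an analysis-suitable $G^1$ two-patch geometry $\mathbf F$. For $\ell=0,1,\dots,N-1$ let $\mathbb W^\ell=\operatorname{span}\Phi^\ell$ be the $C^1$ isogeometric space of level $\ell$ on $\Omega$, constructed on dyadically refined knot vectors as described in the context. The sequence of spaces $\mathbb W^\ell$, $\ell=0,1,\dots,N-1$, is nested, i.e. $$\mathbb W^0\subset\mathbb W^1\subset\dots\subset\mathbb W^{N-1}.$$
   Context: Univariate splines. Let $k,p,r$ be positive integers with $p\ge 3$ and $1\le r\le p-2$, and let $0<\tau_1<\tau_2<\dots<\tau_k<1$ be internal breakpoints. Level $0$ uses these breakpoints: $k^0=k$, $\tau_i^0=\tau_i$. For $\ell\ge 1$, the breakpoints $\tau_1^\ell<\dots<\tau_{k^\ell}^\ell$ of level $\ell$ are obtained from those of level $\ell-1$ by dyadic refinement (adding the midpoint of every knot span of $[0,1]$), so $k^\ell=2k^{\ell-1}+1$. Let $\mathbb S_p^{r,\ell}$ be the space of splines on $[0,1]$ of degree $p$ with respect to the open knot vector in which $0$ and $1$ have multiplicity $p+1$ and each internal breakpoint $\tau_i^\ell$ has multiplicity $p-r$ (so the splines are $C^r$); its B-splines are $N_{i,p}^{r,\ell}$, $i\in\mathbf I^\ell=\{0,\dots,n^\ell-1\}$, $n^\ell=p+1+k^\ell(p-r)$. Let $\mathbb S_p^{r+1,\ell}$ (degree $p$, regularity $r+1$) and $\mathbb S_{p-1}^{r,\ell}$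 (degree $p-1$, regularity $r$) be the analogous spaces with the same internal breakpoints, with B-splines $N_{i,p}^{r+1,\ell}$, $i\in\mathbf I_0^\ell=\{0,\dots,n_0^\ell-1\}$, $n_0^\ell=p+1+k^\ell(p-r-1)$, and $N_{i,p-1}^{r,\ell}$, $i\in\mathbf I_1^\ell=\{0,\dots,n_1^\ell-1\}$, $n_1^\ell=p+k^\ell(p-r-1)$. Geometry. $\mathbf F^{(L)},\mathbf F^{(R)}\in(\mathbb S_p^{r,0}\otimes\mathbb S_p^{r,0})^2$ are regular bijective maps $\mathbf F^{(S)}:[0,1]^2\to\Omega^{(S)}\subset\mathbb R^2$, $S\in\{L,R\}$. The patches share one whole edge $\Gamma=\Omega^{(L)}\cap\Omega^{(R)}$, parameterized by $\mathbf F_0(\xi_2)=\mathbf F^{(L)}(0,\xi_2)=\mathbf F^{(R)}(0,\xi_2)$, $\xi_2\in[0,1]$. The pair $\mathbf F=(\mathbf F^{(L)},\mathbf F^{(R)})$ is analysis-suitable $G^1$ if there are linear functions (polynomials of degree at most one) $\alpha^{(S)},\beta^{(S)}:[0,1]\to\mathbb R$, $S\in\{L,R\}$, with $\alpha^{(L)},\alpha^{(R)}$ relatively prime, such that for all $\xi_2\in[0,1]$: $\alpha^{(L)}(\xi_2)\alpha^{(R)}(\xi_2)<0$, and, with $\beta=\alpha^{(L)}\beta^{(R)}-\alpha^{(R)}\beta^{(L)}$, $$\alpha^{(R)}(\xi_2)\partial_1\mathbf F^{(L)}(0,\xi_2)-\alpha^{(L)}(\xi_2)\partial_1\mathbf F^{(R)}(0,\xi_2)+\beta(\xi_2)\partial_2\mathbf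 F^{(L)}(0,\xi_2)=\mathbf 0 .$$ Among the admissible linear functions, those minimizing $\|\alpha^{(L)}+1\|_{L^2([0,1])}^2+\|\alpha^{(R)}-1\|_{L^2([0,1])}^2$ and $\|\beta^{(L)}\|_{L^2([0,1])}^2+\|\beta^{(R)}\|_{L^2([0,1])}^2$ are fixed once and for all (for all levels). Functions of level $\ell$. $\Phi^\ell=\Phi^\ell_{\Omega^{(L)}}\cup\Phi^\ell_{\Omega^{(R)}}\cup\Phi^\ell_{\Gamma_0}\cup\Phi^\ell_{\Gamma_1}$ is a set of functions on $\Omega$, defined through their compositions with $\mathbf F^{(S)}$, $S\in\{L,R\}$: (1) $\Phi^\ell_{\Omega^{(S')}}=\{\phi^{\Omega^{(S')},\ell}_{i,j}: i\in\mathbf I^\ell\setminus\{0,1\},\ j\in\mathbf I^\ell\}$, $S'\in\{L,R\}$, where $(\phi^{\Omega^{(S')},\ell}_{i,j}\circ\mathbf F^{(S)})(\xi_1,\xi_2)=N_{i,p}^{r,\ell}(\xi_1)N_{j,p}^{r,\ell}(\xi_2)$ if $S=S'$ and $0$ otherwise; (2) $\Phi^\ell_{\Gamma_0}=\{\phi^{\Gamma_0,\ell}_i:i\in\mathbf I_0^\ell\}$, where for $S\in\{L,R\}$ $$(\phi^{\Gamma_0,\ell}_i\circ\mathbf F^{(S)})(\xi_1,\xi_2)=N_{i,p}^{r+1,\ell}(\xi_2)\bigl(N_{0,p}^{r,\ell}(\xi_1)+N_{1,p}^{r,\ell}(\xi_1)\bigr)+\beta^{(S)}(\xi_2)\bigl(N_{i,p}^{r+1,\ell}\bigr)'(\xi_2)\tfrac{\tau_1^\ell}{p}N_{1,p}^{r,\ell}(\xi_1);$$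 (3) $\Phi^\ell_{\Gamma_1}=\{\phi^{\Gamma_1,\ell}_i:i\in\mathbf I_1^\ell\}$, where for $S\in\{L,R\}$ $$(\phi^{\Gamma_1,\ell}_i\circ\mathbf F^{(S)})(\xi_1,\xi_2)=\alpha^{(S)}(\xi_2)N_{i,p-1}^{r,\ell}(\xi_2)N_{1,p}^{r,\ell}(\xi_1).$$ *)

(* Defs.v *)
From HB Require Import structures.
From mathcomp Require Import all_boot all_order all_algebra.
From mathcomp Require Import all_classical all_reals all_analysis.

Set Implicit Arguments.
Unset Strict Implicit.
Unset Printing Implicit Defensive.

Import Order.TTheory GRing.Theory Num.Theory numFieldNormedType.Exports.

Local Open Scope classical_set_scope.
Local Open Scope ring_scope.

(* MathComp-Analysis: R is an arbitrary realType. *)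

Definition span (K : pzRingType) (V : lmodType K) (A : set V) : set V :=
  [set v | exists n (c : 'I_n -> K) (a : 'I_n -> V),
     (forall i, A (a i)) /\ v = \sum_(i < n) c i *: a i].

Section Univariate.
Variable R : realType.

Definition unit_itv : set R := `[0, 1]%classic.

(* Derivative of f : [0,1] -> V; one-sided at 0 and 1.  For x in [0,1] it
   depends only on the values of f on [0,1]. *)
Definition deriv01 (V : normedModType R) (f : R -> V) (x : R) : V :=
  lim ((fun y => (y - x)^-1 *: (f y - f x)) @ within unit_itv x^').

(* Cox-de Boor recursion on the knot sequence t.  Since z / 0 = 0, the terms
   with a vanishing denominator are dropped, as usual.  In degree 0 the last
   nonempty knot span is closed on the right, so that B-splines on an open knot
   vector are continuous up to the right endpoint. *)
Fixpoint bspline (t : seq R) (d i : nat) (x : R) : R :=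
  if d is e.+1 then
    (x - t`_i) / (t`_(i + d) - t`_i) * bspline t e i x +
    (t`_(i + d).+1 - x) / (t`_(i + d).+1 - t`_i.+1) * bspline t e i.+1 x
  else
    ((t`_i <= x < t`_i.+1) ||
     [&& t`_i < x, x == t`_i.+1 & x == last 0 t])%:R.

Definition open_knots (d m : nat) (tau : seq R) : seq R :=
  nseq d.+1 0 ++ flatten [seq nseq m b | b <- tau] ++ nseq d.+1 1.

(* The i-th B-spline of degree d and regularity s with internal breakpoints
   tau, where i < nspl d s tau. *)
Definition Bspl (d s : nat) (tau : seq R) (i : nat) : R -> R :=
  bspline (open_knots d (d - s) tau) d i.

Definition nspl (d s : nat) (tau : seq R) : nat :=
  (d.+1 + size tau * (d - s))%N.

(* The internal breakpoints of the open knot vector are strictly increasing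
   and lie in the open interval (0,1). *)
Definition breakpoints (tau : seq R) : Prop :=
  path <%R 0 (rcons tau 1).

Fixpoint refine_from (a : R) (tau : seq R) : seq R :=
  if tau is b :: tau' then (a + b) / 2 :: b :: refine_from b tau'
  else [:: (a + 1) / 2].

Definition level (tau : seq R) (l : nat) : seq R := iter l (refine_from 0) tau.

End Univariate.

Variant side := sideL | sideR.

Definition same_side (S S' : side) : bool :=
  match S, S' with
  | sideL, sideL | sideR, sideR => true
  | _, _ => false
  end.

Section TwoPatch.
Variable R : realType.

Local Notation I := (@unit_itv R).
Local Notation R2 := 'rV[R]_2.

Definition partial1 (F : R -> R -> R2) (x1 x2 : R) : R2 :=
  deriv01 (fun s => F s x2) x1.

Definition partial2 (F : R -> R -> R2) (x1 x2 : R) : R2 :=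
  deriv01 (fun s => F x1 s) x2.

Definition patch (F : R -> R -> R2) : set R2 :=
  [set y | exists x1 x2, [/\ I x1, I x2 & y = F x1 x2]].

(* F belongs to (S_p^r (x) S_p^r)^2 on [0,1]^2, with control points d. *)
Definition tensor_spline (p r : nat) (tau : seq R) (F : R -> R -> R2) : Prop :=
  exists d : nat -> nat -> R2, forall x1 x2, I x1 -> I x2 ->
    F x1 x2 = \sum_(i < nspl p r tau) \sum_(j < nspl p r tau)
                (Bspl p r tau i x1 * Bspl p r tau j x2) *: d i j.

Definition injective_on_square (F : R -> R -> R2) : Prop :=
  forall x1 x2 y1 y2, I x1 -> I x2 -> I y1 -> I y2 ->
    F x1 x2 = F y1 y2 -> x1 = y1 /\ x2 = y2.

(* The rows of the matrix are the two partial derivatives: it is the transposed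
   Jacobian matrix. *)
Definition regular_map (F : R -> R -> R2) : Prop :=
  forall x1 x2, I x1 -> I x2 ->
    \det (col_mx (partial1 F x1 x2) (partial2 F x1 x2) : 'M[R]_2) != 0.

Definition two_patch_geometry (p r : nat) (tau : seq R)
    (F : side -> R -> R -> R2) : Prop :=
  [/\ forall S, tensor_spline p r tau (F S),
      forall S, regular_map (F S) /\ injective_on_square (F S),
      forall x2, I x2 -> F sideL 0 x2 = F sideR 0 x2 &
      patch (F sideL) `&` patch (F sideR) = F sideL 0 @` I].

Definition gluing_beta (alpha beta : side -> {poly R}) : {poly R} :=
  alpha sideL * beta sideR - alpha sideR * beta sideL.

(* "Linear" functions are polynomials of degree at most one, i.e. of size at
   most 2. *)
Definition gluing_data (F : side -> R -> R -> R2)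
    (alpha beta : side -> {poly R}) : Prop :=
  [/\ forall S, (size (alpha S) <= 2)%N /\ (size (beta S) <= 2)%N,
      coprimep (alpha sideL) (alpha sideR),
      forall x, I x -> (alpha sideL).[x] * (alpha sideR).[x] < 0 &
      forall x, I x ->
        (alpha sideR).[x] *: partial1 (F sideL) 0 x
        - (alpha sideL).[x] *: partial1 (F sideR) 0 x
        + (gluing_beta alpha beta).[x] *: partial2 (F sideL) 0 x = 0].

Definition analysis_suitable_G1 (F : side -> R -> R -> R2) : Prop :=
  exists alpha beta, gluing_data F alpha beta.

Definition sqL2norm (q : {poly R}) : R :=
  (\int[lebesgue_measure]_(x in I) (q.[x] ^+ 2))%R.

(* Whether (beta L, beta R) occurs in admissible data is unaffected by the
   scaling of (alpha L, alpha R), and the latter pair is unique up to scaling;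
   hence the two functionals can be minimized independently. *)
Definition normalized_gluing_data (F : side -> R -> R -> R2)
    (alpha beta : side -> {poly R}) : Prop :=
  gluing_data F alpha beta /\
  forall alpha' beta', gluing_data F alpha' beta' ->
    sqL2norm (alpha sideL + 1) + sqL2norm (alpha sideR - 1)
      <= sqL2norm (alpha' sideL + 1) + sqL2norm (alpha' sideR - 1) /\
    sqL2norm (beta sideL) + sqL2norm (beta sideR)
      <= sqL2norm (beta' sideL) + sqL2norm (beta' sideR).

Section Space.
Variables (p r : nat) (tau : seq R).
Variables (F : side -> R -> R -> R2) (alpha beta : side -> {poly R}).

Definition Omega : set R2 := patch (F sideL) `|` patch (F sideR).

(* In Omega -> R below, an x : Omega is a point of R^2 together with a proof that it lies in Omega. *)
Local Notation funOmega := (Omega -> R).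

Definition has_pullbacks (phi : funOmega) (g : side -> R -> R -> R) : Prop :=
  forall S x1 x2 (x : Omega), I x1 -> I x2 ->
    val x = F S x1 x2 -> phi x = g S x1 x2.

Definition pull_patch (l : nat) (S' : side) (i j : nat)
    (S : side) (x1 x2 : R) : R :=
  if same_side S S'
  then Bspl p r (level tau l) i x1 * Bspl p r (level tau l) j x2 else 0.

Definition pull_Gamma0 (l i : nat) (S : side) (x1 x2 : R) : R :=
  let t := level tau l in
  Bspl p r.+1 t i x2 * (Bspl p r t 0 x1 + Bspl p r t 1 x1)
  + (beta S).[x2] * deriv01 (Bspl p r.+1 t i) x2
    * (t`_0 / p%:R * Bspl p r t 1 x1).

Definition pull_Gamma1 (l i : nat) (S : side) (x1 x2 : R) : R :=
  let t := level tau l in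
  (alpha S).[x2] * Bspl p.-1 r t i x2 * Bspl p r t 1 x1.

Definition Phi_patch (l : nat) (S' : side) : set funOmega :=
  [set phi | exists i j, [/\ (2 <= i < nspl p r (level tau l))%N,
     (j < nspl p r (level tau l))%N & has_pullbacks phi (pull_patch l S' i j)]].

Definition Phi_Gamma0 (l : nat) : set funOmega :=
  [set phi | exists2 i, (i < nspl p r.+1 (level tau l))%N &
     has_pullbacks phi (pull_Gamma0 l i)].

Definition Phi_Gamma1 (l : nat) : set funOmega :=
  [set phi | exists2 i, (i < nspl p.-1 r (level tau l))%N &
     has_pullbacks phi (pull_Gamma1 l i)].

Definition Phi (l : nat) : set funOmega :=
  Phi_patch l sideL `|` Phi_patch l sideR `|` Phi_Gamma0 l `|` Phi_Gamma1 l.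

Definition W (l : nat) : set funOmega := span (Phi l).

End Space.
End TwoPatch.

Arguments W {R} p r tau F alpha beta l.

(* Main.v *)
(** On [0,1], the B-splines of degree d and smoothness s on an open knot vector
    span the same space as the powers x^j (j <= d) and the truncated powers
    (x - b)_+^j (s < j <= d, b a breakpoint).  Marsden's identity puts the latter
    family in the span of the B-splines; it is free and has as many elements as
    there are B-splines, so the transition matrix is invertible.  In the truncated
    power basis, inclusion under refinement or under lowering the smoothness,
    differentiation, and multiplication by a linear polynomial are immediate.

    Near 0 only the first two B-splines have a nonzero value or slope.  Matching
    values and slopes at 0, N_0 + N_1 and (tau_1/p) N_1 of level l equal their
    level l+1 analogues up to B-splines of index >= 2.  Hence a level l edge
    function is a combination of level l+1 edge functions plus terms
    N_m(x1) f(x2) with m >= 2 and f a spline of degree p and smoothness r, and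
    such terms are combinations of level l+1 patch functions. *)

Require Import Defs.
From mathcomp Require Import all_boot all_order all_algebra.
From mathcomp Require Import all_classical all_reals all_analysis.
From mathcomp Require Import ring lra zify.
Import Order.TTheory GRing.Theory Num.Theory numFieldNormedType.Exports.
Local Open Scope classical_set_scope.
Local Open Scope ring_scope.

Set Implicit Arguments.
Unset Strict Implicit.
Unset Printing Implicit Defensive.

Lemma unit_itvE (R : realType) (x : R) : unit_itv x <-> 0 <= x <= 1.
Proof. by rewrite /unit_itv /= in_itv. Qed.

(** * Marsden's identity on a knot sequence *)

Section Knots.
Variables (R : realType) (t : seq R) (mu : nat) (x : R).
(** Says that x lies in the knot span of index [mu]. Phrasing it through degree 0 lets the right
    endpoint, which belongs to the closed last span, be treated like any other point. *)
Hypothesis span_mu : forall i, bspline t 0 i x = (i == mu)%:R.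

Lemma bspline_local e i : ~~ (i <= mu <= i + e)%N -> bspline t e i x = 0.
Proof.
elim: e i => [|e IH] i hi.
  by rewrite span_mu (_ : (i == mu) = false) //; apply/eqP; lia.
by rewrite /= !IH ?mulr0 ?addr0 //; lia.
Qed.

(** Induction on the degree. The strict inequalities between knots on either side of x keep the
    denominators of all B-splines alive at x nonzero. *)
Lemma marsden e : (e <= mu)%N ->
  (forall i j, (i <= mu < j)%N -> (j <= mu + e)%N -> t`_i < t`_j) ->
  \sum_(i < mu.+1) bspline t e i x *: \prod_(j < e) ('X - (t`_(i + j.+1))%:P)
    = ('X - x%:P) ^+ e.
Proof.
elim: e => [|e IH] emu lt_t.
  rewrite big_ord_recr /= big1 ?add0r => [|i _].
    by rewrite -[X in X *: _]/(bspline t 0 mu x) span_mu eqxx scale1r big_ord0.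
  rewrite -[X in X *: _]/(bspline t 0 i x) span_mu.
  by rewrite (_ : (_ == _) = false) ?scale0r //; apply/eqP; have := ltn_ord i; lia.
have {}IH := IH (ltnW emu).
rewrite exprSr -IH; last by move=> i j h1 h2; apply: lt_t => //; lia.
pose psi i := \prod_(j < e) ('X - (t`_(i + j.+1))%:P) : {poly R}.
pose C i := bspline t e i x.
(* [H i] and [G i] collect the two contributions of the degree e B-spline of index i to degree e +
   1: [H i] through index i, [G i] through index i - 1. *)
pose G i := ((t`_(i + e.+1) - x) / (t`_(i + e.+1) - t`_i) * C i)
              *: (('X - (t`_i)%:P) * psi i).
pose H i := ((x - t`_i) / (t`_(i + e.+1) - t`_i) * C i)
              *: (psi i * ('X - (t`_(i + e.+1))%:P)).
have -> : \sum_(i < mu.+1) bspline t e.+1 i x *: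
      \prod_(j < e.+1) ('X - (t`_(i + j.+1))%:P)
    = \sum_(i < mu.+1) H i + \sum_(i < mu.+1) G i.+1.
  rewrite -big_split; apply: eq_bigr => i _ /=.
  rewrite scalerDl; congr (_ + _); first by rewrite /H /psi big_ord_recr.
  rewrite /G /psi big_ord_recl /= addn1 -addSnnS; congr (_ *: (_ * _)); first by rewrite addnS.
  by apply: eq_bigr => j _; rewrite /bump /= add1n addnS addSn.
(* The end terms of the shift vanish: since e < mu, the support of index 0 ends before x, and that
   of index mu + 1 starts after it. *)
have -> : \sum_(i < mu.+1) G i.+1 = \sum_(i < mu.+1) G i.
  have G0 : G 0 = 0 by rewrite /G /C bspline_local ?mulr0 ?scale0r //; lia.
  have GM : G mu.+1 = 0 by rewrite /G /C bspline_local ?mulr0 ?scale0r //; lia.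
  have := big_ord_recl (idx := 0) (op := +%R) mu.+1 (fun i : 'I_mu.+2 => G i).
  by rewrite big_ord_recr /= GM addr0 G0 add0r => ->.
rewrite -big_split mulr_suml; apply: eq_bigr => i _ /=; rewrite /G /H /C.
have [hi|hi] := boolP (i <= mu <= i + e)%N; last first.
  by rewrite bspline_local // !mulr0 !scale0r mul0r addr0.
have lti : t`_i < t`_(i + e.+1) by apply: lt_t; lia.
have ne : t`_(i + e.+1) - t`_i != 0 by rewrite subr_eq0 gt_eqF.
rewrite -/(psi i) -!mul_polyC.
(* 'X - x is the affine combination of the two linear factors in [H i] and [G i], with exactly the
   recursion weights. *)
have -> : ('X - x%:P : {poly R}) =
   ((x - t`_i) / (t`_(i + e.+1) - t`_i))%:P * ('X - (t`_(i + e.+1))%:P)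
 + ((t`_(i + e.+1) - x) / (t`_(i + e.+1) - t`_i))%:P * ('X - (t`_i)%:P).
  apply/polyP => j; rewrite !(coefD, coefN, coefX, coefC, coefCM).
  by case: (j == 0%N); case: (j == 1%N); field.
rewrite !polyCM; ring.
Qed.

End Knots.

(** * Open knot vectors and their knot spans *)

Section OpenKnots.
Variables (R : realType) (d m : nat) (tau : seq R).

Local Notation t := (open_knots d m tau).

Lemma flatten_nseq_size : size (flatten [seq nseq m b | b <- tau]) = (size tau * m)%N.
Proof. by elim: tau => //= b s IH; rewrite size_cat size_nseq IH mulSn. Qed.

Lemma nth_flatten_nseq i q : (i < size tau)%N -> (q < m)%N ->
  (flatten [seq nseq m b | b <- tau])`_(i * m + q) = tau`_i.
Proof.
elim: tau i => //= b s IH [|i] hi hq.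
  by rewrite nth_cat size_nseq mul0n add0n hq nth_nseq hq.
rewrite nth_cat size_nseq mulSn -addnA ltnNge leq_addr /= addKn.
exact: IH.
Qed.

Lemma size_open_knots : size t = (d.+1 + size tau * m + d.+1)%N.
Proof. by rewrite /open_knots !size_cat !size_nseq flatten_nseq_size addnA. Qed.

Lemma open_knots_lo i : (i <= d)%N -> t`_i = 0.
Proof. by move=> hi; rewrite /open_knots nth_cat size_nseq ltnS hi nth_nseq ltnS hi. Qed.

Lemma open_knots_mid i q : (i < size tau)%N -> (q < m)%N ->
  t`_(d.+1 + i * m + q) = tau`_i.
Proof.
move=> hi hq; rewrite /open_knots nth_cat size_nseq -addnA ltnNge leq_addr /= addKn.
rewrite nth_cat flatten_nseq_size (_ : (_ < _)%N); first exact: nth_flatten_nseq.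
by nia.
Qed.

Lemma open_knots_hi i : (d.+1 + size tau * m <= i)%N ->
  (i < d.+1 + size tau * m + d.+1)%N -> t`_i = 1.
Proof.
move=> h1 h2; rewrite /open_knots nth_cat size_nseq ifF; last by lia.
rewrite nth_cat flatten_nseq_size ifF; last by lia.
by rewrite nth_nseq ifT //; lia.
Qed.

Lemma open_knots_oversize i : (d.+1 + size tau * m + d.+1 <= i)%N -> t`_i = 0.
Proof. by move=> hi; rewrite nth_default // size_open_knots. Qed.

Hypothesis tauP : breakpoints tau.

Lemma breakpoints_itv b : b \in tau -> 0 < b < 1.
Proof.
move=> hb; move: (tauP); rewrite /breakpoints rcons_path => /andP[h1 h2].
have h0 : 0 < b by have /allP/(_ _ hb) := order_path_min lt_trans h1.
rewrite h0 /=; move: h1 h2; case/splitPr: hb => s1 s2.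
rewrite cat_path /= last_cat /= => /andP[_ /andP[_ h]] hl.
have : path <%R b (rcons s2 1) by rewrite rcons_path h.
by move/(order_path_min lt_trans)/allP/(_ 1); rewrite mem_rcons mem_head; apply.
Qed.

Lemma breakpoints_sorted : sorted <%R tau.
Proof.
by move: tauP; rewrite /breakpoints rcons_path => /andP[/path_sorted].
Qed.

Lemma open_knots_mono i j : (i <= j)%N -> (j < d.+1 + size tau * m + d.+1)%N ->
  t`_i <= t`_j.
Proof.
move=> ij hj.
have nseq_path (a b : R) n s : a <= b -> path <=%R b s -> path <=%R a (nseq n b ++ s).
  elim: n a => [|n IH] a ab hs /=; first exact: (path_le (@le_trans _ R) ab hs).
  by rewrite ab IH.
have : sorted <=%R t.
  rewrite /open_knots; apply: (@path_sorted _ _ 0); apply: (nseq_path) => //.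
  move: tauP; rewrite /breakpoints; move: (0); elim: (tau) => [|b s IH] a /=.
    rewrite andbT => /ltW ->; rewrite -(cats0 (nseq d 1)).
    by rewrite nseq_path.
  by case/andP => /ltW ab h; rewrite -catA; apply: (nseq_path) => //; apply: IH.
move/(sorted_leq_nth le_trans lexx 0) => h; apply: h => //; rewrite inE size_open_knots //.
exact: leq_ltn_trans ij hj.
Qed.

Lemma open_knots_itv i : 0 <= t`_i <= 1.
Proof.
have [hi|hi] := ltnP i (d.+1 + size tau * m + d.+1); last first.
  by rewrite open_knots_oversize // lexx ler01.
rewrite -{1}(open_knots_lo (leq0n d)) open_knots_mono //=.
rewrite -(@open_knots_hi (d.+1 + size tau * m + d)%N); [|lia|lia].
by apply: open_knots_mono; lia.
Qed.

Lemma open_knots_span (x : R) : 0 <= x <= 1 ->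
  exists mu, [/\ (d <= mu < d.+1 + size tau * m)%N,
    forall i, bspline t 0 i x = (i == mu)%:R,
    t`_mu <= x, (x < t`_mu.+1) || (t`_mu.+1 == 1) & t`_mu < t`_mu.+1].
Proof.
move=> /andP[x0 x1]; set n := (d.+1 + size tau * m)%N.
(* [mu] will be the last index satisfying [A]. The condition t_i < 1 places x = 1 in the last
   nonempty span. *)
pose A i := [&& (i < n + d.+1)%N, t`_i <= x & t`_i < 1].
have Ad : A d by rewrite /A open_knots_lo // x0 ltr01 !andbT; lia.
have Amax i : A i -> (i <= n + d.+1)%N by case/and3P => /ltnW.
have [mu /and3P[mu_n t_mu_x t_mu_1] mu_max] := ex_maxnP (ex_intro _ d Ad) Amax.
have mun : (mu < n)%N.
  by rewrite ltnNge; apply/negP => h; move: t_mu_1; rewrite open_knots_hi ?ltxx.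
have hS : (x < t`_mu.+1) || (t`_mu.+1 == 1).
  have : ~~ A mu.+1 by apply/negP => /mu_max; rewrite ltnn.
  have /andP[_ h1] := open_knots_itv mu.+1.
  rewrite /A (_ : (mu.+1 < n + d.+1)%N) /=; last by lia.
  by rewrite negb_and -ltNge -leNgt => /orP[->//|h]; rewrite eq_le h1 h orbT.
have ltS : t`_mu < t`_mu.+1.
  by case/orP: hS => [/(le_lt_trans t_mu_x)//|/eqP ->].
exists mu; split => //; first by rewrite mun mu_max.
move=> i; have -> : bspline t 0 i x = ((t`_i <= x < t`_i.+1) ||
    [&& t`_i < x, x == t`_i.+1 & x == last 0 t])%:R by [].
congr ((nat_of_bool _)%:R); have -> : last 0 t = 1.
  by rewrite -nth_last size_open_knots open_knots_hi //; lia.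
have [->{i}|imu] := eqVneq i mu.
  case: (ltP x t`_mu.+1) hS => /= [h _|h /eqP h1]; first by rewrite t_mu_x.
  have x_1 : x = 1 by apply/le_anti; rewrite x1 -h1 h.
  by rewrite h1 x_1 eqxx t_mu_1 orbT.
(* Beyond the knot vector both knots are the default value 0, so the degree-0 B-spline vanishes on
   [0,1]. *)
have [hi|hi] := ltnP i (n + d.+1); last first.
  by rewrite !open_knots_oversize //; [case: (ltgtP x 0) x0|lia].
have [lt|ge] := ltnP i mu.
  have h1 : t`_i.+1 <= t`_mu by apply: open_knots_mono => //; lia.
  rewrite [x < _]ltNge (le_trans h1 t_mu_x) andbF orFb.
  apply/negbTE/negP => /and3P[_ /eqP e1 /eqP e2].
  by move: (le_lt_trans h1 t_mu_1); rewrite -e1 -e2 ltxx.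
have : ~~ A i by apply/negP => /mu_max; lia.
have /andP[_ ti1] := open_knots_itv i; have /andP[_ tS1] := open_knots_itv i.+1.
rewrite /A hi /= negb_and -ltNge -leNgt => /orP[h|h].
  by rewrite [_ <= x]leNgt h [_ < x]ltNge (ltW h).
apply/negbTE/negP => /orP[/andP[h1 h2]|/andP[h1 _]].
  by move: (lt_le_trans (le_lt_trans (le_trans h h1) h2) tS1); rewrite ltxx.
by move: (lt_le_trans h1 x1); rewrite ltNge h.
Qed.

End OpenKnots.

(** * Powers and truncated powers as combinations of B-splines *)

Section SplineSpace.
Variables (R : realType) (d s : nat) (tau : seq R).

Local Notation m := (d - s)%N.
Local Notation t := (open_knots d (d - s) tau).
Local Notation n := (nspl d s tau).

Definition bspline_span (f : R -> R) : Prop :=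
  exists c : nat -> R, forall x, unit_itv x ->
    f x = \sum_(i < n) c i * Bspl d s tau i x.

Lemma bspline_span_eq f g : (forall x, unit_itv x -> f x = g x) ->
  bspline_span g -> bspline_span f.
Proof. by move=> fg [c hc]; exists c => x hx; rewrite fg // hc. Qed.

Lemma bspline_spanZ a f : bspline_span f -> bspline_span (fun x => a * f x).
Proof.
move=> [c hc]; exists (fun i => a * c i) => x hx.
by rewrite hc // mulr_sumr; apply: eq_bigr => i _; rewrite mulrA.
Qed.

Lemma bspline_spanD f g : bspline_span f -> bspline_span g ->
  bspline_span (fun x => f x + g x).
Proof.
move=> [c hc] [c' hc']; exists (fun i => c i + c' i) => x hx.
by rewrite hc // hc' // -big_split; apply: eq_bigr => i _; rewrite mulrDl.
Qed.

Lemma bspline_span_sum (I : eqType) (r : seq I) (f : I -> R -> R) :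
  (forall i, i \in r -> bspline_span (f i)) ->
  bspline_span (fun x => \sum_(i <- r) f i x).
Proof.
elim: r => [|i r IH] h.
  exists (fun=> 0) => x _; rewrite big_nil big1 // => i _; exact: mul0r.
apply: (@bspline_span_eq _ (fun x => f i x + \sum_(i <- r) f i x)) => [x _|].
  by rewrite big_cons.
by apply: bspline_spanD; [apply: h; rewrite mem_head
  | apply: IH => j hj; apply: h; rewrite inE hj orbT].
Qed.

(* The Taylor expansion at [b] of the dual polynomial attached to the i-th
   B-spline by Marsden's identity. *)
Definition dual_poly (b : R) (i : nat) : {poly R} :=
  \prod_(0 <= j < d) ('X + (b - t`_(i + j.+1))%:P).

(** The m knots equal to b all lie among t_(i+1), ..., t_(i+d). Each contributes a factor 'X, so
    'X^m divides the product. *)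
Lemma dual_poly_coef_eq0 b i J q : (i < J)%N -> (J + m <= (i + d).+1)%N ->
  (forall j, (j < m)%N -> t`_(J + j) = b) -> (q < m)%N -> (dual_poly b i)`_q = 0.
Proof.
move=> iJ Jm tb qm; rewrite /dual_poly.
rewrite (big_cat_nat (n := (J - i.+1)%N)) //=; last by lia.
rewrite (big_cat_nat (m := (J - i.+1)%N) (n := (J - i.+1 + m)%N)) //=; [|lia|lia].
rewrite [X in _ * (X * _)](_ : _ = 'X^m).
  by rewrite mulrCA coefXnM qm.
rewrite -[in RHS](addKn (J - i.+1) m) -prodr_const_nat.
apply: eq_big_nat => j /andP[h1 h2].
rewrite (_ : (i + j.+1)%N = (J + (i + j.+1 - J))%N); last by lia.
by rewrite tb ?subrr ?addr0 //; lia.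
Qed.

Hypothesis tauP : breakpoints tau.

(** Substitute 'X + b in Marsden's identity, expand the right side by the binomial theorem and
    compare coefficients of degree q. The indices above [mu] can be added because those B-splines
    vanish at x. *)
Lemma marsden_coef b q x : (q <= d)%N -> unit_itv x ->
  \sum_(i < n) (dual_poly b i)`_q * Bspl d s tau i x
    = 'C(d, q)%:R * (b - x) ^+ (d - q).
Proof.
move=> qd /unit_itvE hx.
have [mu [/andP[dmu mun] h0 mux _ tlt]] := open_knots_span d m tauP hx.
have lt_t i j : (i <= mu < j)%N -> (j <= mu + d)%N -> t`_i < t`_j.
  move=> /andP[h1 h2] h3; apply: (@le_lt_trans _ _ t`_mu).
    by apply: open_knots_mono => //; lia.
  by apply: (lt_le_trans tlt); apply: open_knots_mono => //; lia.
have /(congr1 (fun p => (p \Po ('X + b%:P))`_q)) := marsden h0 dmu lt_t.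
rewrite rmorphXn /= !(raddfB, raddfD, rmorph_sum) /= comp_polyX comp_polyC.
rewrite -addrA -polyCN -polyCD exprDn !coef_sum.
have -> : (\sum_(i < d.+1) ('X^(d - i) * (b - x)%:P ^+ i *+ 'C(d, i))`_q)
    = 'C(d, q)%:R * (b - x) ^+ (d - q).
  have hq : (d - q < d.+1)%N by lia.
  rewrite (bigD1 (Ordinal hq)) //= big1 => [|i /eqP ne].
    rewrite addr0 coefMn -polyC_exp coefMC coefXn subKn // eqxx mul1r.
    by rewrite bin_sub // mulr_natl.
  rewrite coefMn -polyC_exp coefMC coefXn; case: eqP => [e|]; last by rewrite mul0r mul0rn.
  by case: ne; apply: val_inj => /=; have := ltn_ord i; lia.
move=> <-; transitivity (\sum_(i < mu.+1) (dual_poly b i)`_q * Bspl d s tau i x).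
  rewrite [RHS](big_ord_widen n (fun i => (dual_poly b i)`_q * Bspl d s tau i x)) //.
  rewrite [RHS]big_mkcond; apply: eq_bigr => i _; case: ifP => // hi.
  by rewrite /Bspl (bspline_local h0) ?mulr0 // -ltnS hi.
apply: eq_bigr => i _; rewrite comp_polyZ coefZ [RHS]mulrC; congr (_`_q * _); congr polyseq.
rewrite rmorph_prod /dual_poly big_mkord; apply: eq_bigr => j _ /=.
by rewrite comp_polyB comp_polyX comp_polyC polyCB addrA.
Qed.

Lemma bspline_span_Xn e : (e <= d)%N -> bspline_span (fun x => x ^+ e).
Proof.
(* [marsden_coef] with b = 0 and q = d - e gives a multiple of (-x)^e; [C] cancels the sign and the
   binomial coefficient. *)
move=> ed; pose C : R := (-1) ^+ e / 'C(d, d - e)%:R.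
apply: (@bspline_span_eq _ (fun x => C * (\sum_(i < n)
    (dual_poly 0 i)`_(d - e) * Bspl d s tau i x))) => [x hx|].
  rewrite marsden_coef ?leq_subr // subKn // sub0r [(- x) ^+ _]exprNn mulrA /C divfK.
    by rewrite mulrA -exprMn mulrNN mulr1 expr1n mul1r.
  by rewrite pnatr_eq0 -lt0n bin_gt0 leq_subr.
by apply: bspline_spanZ; exists (fun i => (dual_poly 0 i)`_(d - e)).
Qed.

(** Keep in Marsden's expansion of (b - x)^e only the indices from [J] on, [J] being the first knot
    equal to b. For x < b none of these B-splines has started. For x >= b nothing is lost: a dropped
    B-spline either ends before x or has all m copies of b among the roots of its dual polynomial,
    whose coefficient of degree d - e < m is then 0. *)
Lemma bspline_span_trunc (b : R) e : b \in tau -> (s < e <= d)%N ->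
  bspline_span (fun x => (b <= x)%R%:R * (x - b) ^+ e).
Proof.
move=> hb /andP[se ed]; pose C : R := (-1) ^+ e / 'C(d, d - e)%:R.
have /andP[_ b1] := breakpoints_itv tauP hb.
pose J := (d.+1 + index b tau * m)%N.
have tJ j : (j < m)%N -> t`_(J + j) = b.
  by move=> hj; rewrite open_knots_mid ?nth_index ?index_mem.
have Jn : (J + m <= d.+1 + size tau * m)%N.
  have : (index b tau < size tau)%N by rewrite index_mem.
  by rewrite /J; nia.
pose c i := if (J <= i)%N then (dual_poly b i)`_(d - e) else 0.
apply: (@bspline_span_eq _ (fun x => C * (\sum_(i < n) c i * Bspl d s tau i x))) => [x hx|];
  last by apply: bspline_spanZ; exists c.
have [mu [/andP[dmu mun] h0 mux xmu tlt]] := open_knots_span d m tauP ((unit_itvE x).1 hx).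
have [bx|xb] := leP b x.
  have muJ : (J + m <= mu.+1)%N.
    rewrite leqNgt; apply/negP => h.
    have tS : t`_mu.+1 <= b.
      by rewrite -(tJ m.-1); [apply: open_knots_mono => //; lia | lia].
    case/orP: xmu => [|/eqP e1]; first by rewrite ltNge (le_trans tS bx).
    by move: b1; rewrite ltNge -e1 tS.
  have -> : \sum_(i < n) c i * Bspl d s tau i x =
      \sum_(i < n) (dual_poly b i)`_(d - e) * Bspl d s tau i x.
    apply: eq_bigr => i _; rewrite /c; case: leqP => // iJ; rewrite mul0r.
    have [h|h] := leqP (J + m) (i + d).+1.
      by rewrite (@dual_poly_coef_eq0 _ _ J) ?mul0r //; lia.
    by rewrite /Bspl (bspline_local h0) ?mulr0 //; lia.
  rewrite marsden_coef ?leq_subr // subKn // mul1r mulrA /C divfK.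
    by rewrite -exprMn mulN1r opprB.
  by rewrite pnatr_eq0 -lt0n bin_gt0 leq_subr.
rewrite mul0r big1 ?mulr0 // => i _; rewrite /c; have [Ji|_] := leqP J i; last exact: mul0r.
have : (mu < J)%N.
  rewrite ltnNge; apply/negP => h; move: xb; rewrite ltNge (le_trans _ mux) //.
  by rewrite -(tJ 0%N); [rewrite addn0; apply: open_knots_mono => //; lia|lia].
by move=> h; rewrite /Bspl (bspline_local h0) ?mulr0 //; lia.
Qed.

End SplineSpace.

(** * Independence of truncated powers and inversion of a free family *)

Lemma poly_itv_eq0 (R : realFieldType) (p : {poly R}) (a c : R) : a < c ->
  (forall x, a <= x < c -> p.[x] = 0) -> p = 0.
Proof.
move=> ac hp; apply/eqP/negPn/negP => pn0.
(* Infinitely many distinct points of the interval, hence more roots than a nonzero polynomial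
   admits. *)
pose f (i : nat) : R := a + (c - a) / i.+2%:R.
have c0 : 0 < c - a by rewrite subr_gt0.
have finj : injective f.
  move=> i j /addrI /(mulfI (lt0r_neq0 c0)) /invr_inj /eqP.
  by rewrite eqr_nat => /eqP [].
have := max_poly_roots pn0 (rs := map f (iota 0 (size p))).
rewrite size_map size_iota ltnn map_inj_uniq ?iota_uniq // => h.
suff : false by []; apply: h => //; apply/allP => _ /mapP [i _ ->].
apply/eqP/hp; rewrite lerDl divr_ge0 ?ler0n ?ltW //= -ltrBrDl.
by rewrite ltr_pdivrMr // ltr_pMr // ltr1n.
Qed.

(** Breakpoints are treated from left to right. Before the first one, b, only [P] is active, so [P]
    is 0; on [b,1] the first piece, shifted by b, takes over the role of [P]. *)
Lemma truncated_poly_indep (R : realFieldType) (tau : seq R) (a : R)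
    (P : {poly R}) (Q : 'I_(size tau) -> {poly R}) :
  path <%R a (rcons tau 1) ->
  (forall x, a <= x <= 1 ->
    P.[x] + \sum_(i < size tau) (tau`_i <= x)%R%:R * (Q i).[x - tau`_i] = 0) ->
  P = 0 /\ forall i, Q i = 0.
Proof.
elim: tau a P Q => [|b tau IH] a P Q /=.
  rewrite andbT => a1 h; split; last by case.
  apply: (poly_itv_eq0 a1) => x /andP[ax xc].
  by have := h x; rewrite big_ord0 addr0; apply; rewrite ax ltW.
move=> /andP[ab pb] h.
have b1 : b < 1.
  by have /allP := order_path_min lt_trans pb; apply; rewrite mem_rcons mem_head.
have P0 : P = 0.
  apply: (poly_itv_eq0 ab) => x /andP[ax xb].
  rewrite -[RHS](h x) ?ax ?(ltW (lt_trans xb b1)) // big1 ?addr0 // => i _.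
  rewrite leNgt (_ : x < (b :: tau)`_i) ?mul0r //.
  case: i => [[|i] hi] //=; apply: (lt_trans xb).
  have /allP := order_path_min lt_trans pb; apply.
  by rewrite mem_rcons inE mem_nth ?orbT.
have [|Q0 QS] := IH b (Q ord0 \Po ('X - b%:P)) (fun i => Q (lift ord0 i)) pb.
  move=> x /andP[bx x1]; rewrite -[RHS](h x) ?x1 ?(le_trans (ltW ab)) //.
  by rewrite P0 horner0 add0r big_ord_recl /= bx mul1r horner_comp !hornerE.
split=> // i; case: (unliftP ord0 i) => [j ->|->]; first exact: QS.
have := congr1 (fun p => p \Po ('X + b%:P)) Q0.
by rewrite -comp_polyA comp_polyB comp_polyX comp_polyC addrK comp_polyXr comp_poly0.
Qed.

(** Indexing [B] by the cardinal of [J] makes the transition matrix square. Freeness of [G] makes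
    its left kernel trivial, so it is invertible, and a row of the inverse gives the coefficients of
    [B i]. *)
Lemma invert_free_family (R : fieldType) (D : set R) (J : finType)
    (G : J -> R -> R) (B : 'I_#|J| -> R -> R) (M : J -> 'I_#|J| -> R) :
  (forall a x, D x -> G a x = \sum_i M a i * B i x) ->
  (forall v : J -> R, (forall x, D x -> \sum_a v a * G a x = 0) -> forall a, v a = 0) ->
  forall i, exists c : J -> R, forall x, D x -> B i x = \sum_a c a * G a x.
Proof.
move=> GB indep i.
have sumJ (F : J -> R) : \sum_a F a = \sum_(j < #|J|) F (enum_val j).
  by rewrite (reindex (@enum_val J xpredT)) //; apply/onW_bij/enum_val_bij.
pose A : 'M[R]_#|J| := \matrix_(a, j) M (enum_val a) j.
have Aunit : A \in unitmx.
  rewrite -row_free_unit; apply: inj_row_free => v vA.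
  apply/rowP => j; rewrite mxE -(enum_valK j).
  apply: (indep (fun a => v 0 (enum_rank a))) => x Dx.
  under eq_bigr => a _ do rewrite GB // mulr_sumr.
  rewrite exchange_big big1 // => k _ /=.
  under eq_bigr => a _ do rewrite mulrA.
  rewrite -mulr_suml sumJ.
  move/rowP/(_ k): vA; rewrite !mxE => vA.
  rewrite (eq_bigr (fun a => v 0 a * A a k)) ?vA ?mul0r // => a _.
  by rewrite mxE enum_valK.
exists (fun a => invmx A i (enum_rank a)) => x Dx.
under eq_bigr => a _ do rewrite GB // mulr_sumr.
transitivity (\sum_k (invmx A *m A) i k * B k x).
  rewrite mulVmx // (bigD1 i) //= mxE eqxx mul1r big1 ?addr0 // => k ki.
  by rewrite mxE eq_sym (negbTE ki) mul0r.
rewrite exchange_big; apply: eq_bigr => k _ /=.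
rewrite mxE mulr_suml sumJ; apply: eq_bigr => a _.
by rewrite mxE enum_valK mulrA.
Qed.

(** * Splines as a polynomial plus truncated pieces *)

Section PiecewisePolynomials.
Variables (R : realType).
Implicit Types (d s : nat) (tau : seq R) (f g : R -> R).

(** The pieces are indexed by the breakpoint itself, not by its rank, so that refinement leaves the
    old pieces in place and sets the new ones to 0. *)
Definition truncated_poly tau (P : {poly R}) (Q : R -> {poly R}) (x : R) : R :=
  P.[x] + \sum_(b <- tau) (b <= x)%R%:R * (Q b).[x - b].

Definition spline_data d s (P : {poly R}) (Q : R -> {poly R}) : Prop :=
  [/\ (size P <= d.+1)%N, forall b, (size (Q b) <= d.+1)%N &
      forall b j, (j <= s)%N -> (Q b)`_j = 0].

(* For [b] in [tau], [Q b] carries the truncated powers (x - b)_+^j, s < j <= d. *)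
Definition spline d s tau f : Prop :=
  exists P Q, spline_data d s P Q /\
    forall x, unit_itv x -> f x = truncated_poly tau P Q x.

Lemma spline_eq d s tau f g : (forall x, unit_itv x -> f x = g x) ->
  spline d s tau g -> spline d s tau f.
Proof. by move=> fg [P [Q [h e]]]; exists P, Q; split => // x hx; rewrite fg ?e. Qed.

Lemma splineZ d s tau a f : spline d s tau f -> spline d s tau (fun x => a * f x).
Proof.
move=> [P [Q [[h1 h2 h3] e]]]; exists (a *: P), (fun b => a *: Q b); split.
  split=> [|b|b j js]; rewrite ?coefZ ?h3 ?mulr0 //; exact: (leq_trans (size_scale_leq _ _)).
move=> x hx; rewrite e // /truncated_poly mulrDr hornerZ mulr_sumr; congr (_ + _).
by apply: eq_bigr => b _; rewrite hornerZ mulrCA.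
Qed.

Lemma splineD d s tau f g : spline d s tau f -> spline d s tau g ->
  spline d s tau (fun x => f x + g x).
Proof.
move=> [P [Q [[h1 h2 h3] e]]] [P' [Q' [[h1' h2' h3'] e']]].
exists (P + P'), (fun b => Q b + Q' b); split.
  split=> [|b|b j js]; rewrite ?coefD ?h3 ?h3' ?addr0 //.
    by apply: leq_trans (size_polyD _ _) _; rewrite geq_max h1.
  by apply: leq_trans (size_polyD _ _) _; rewrite geq_max h2 h2'.
move=> x hx; rewrite e // e' // /truncated_poly hornerD addrACA -big_split; congr (_ + _).
by apply: eq_bigr => b _; rewrite hornerD mulrDr.
Qed.

Lemma spline0 d s tau : spline d s tau (fun=> 0).
Proof.
exists 0, (fun=> 0); split; first by split=> *; rewrite ?size_poly0 ?coef0.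
by move=> x _; rewrite /truncated_poly horner0 big1 ?addr0 // => b _; rewrite horner0 mulr0.
Qed.

Lemma spline_sum d s tau (I : Type) (r : seq I) (f : I -> R -> R) :
  (forall i, spline d s tau (f i)) -> spline d s tau (fun x => \sum_(i <- r) f i x).
Proof.
move=> h; elim: r => [|i r IH].
  by apply: spline_eq (spline0 d s tau) => x _; rewrite big_nil.
by apply: spline_eq (splineD (h i) IH) => x _; rewrite big_cons.
Qed.

Lemma spline_Xn d s tau e : (e <= d)%N -> spline d s tau (fun x => x ^+ e).
Proof.
move=> ed; exists 'X^e, (fun=> 0); split.
  by split=> *; rewrite ?size_polyXn ?size_poly0 ?coef0.
move=> x _; rewrite /truncated_poly hornerXn big1 ?addr0 // => b _.
by rewrite horner0 mulr0.
Qed.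

Lemma spline_trunc d s tau (b : R) e : uniq tau -> b \in tau -> (s < e <= d)%N ->
  spline d s tau (fun x => (b <= x)%R%:R * (x - b) ^+ e).
Proof.
move=> tau_uniq hb /andP[se ed].
exists 0, (fun c => if c == b then 'X^e else 0); split.
  split=> [|c|c j js]; first by rewrite size_poly0.
    by case: ifP; rewrite ?size_polyXn ?size_poly0.
  by case: ifP; rewrite ?coef0 // coefXn ltn_eqF ?(leq_ltn_trans js).
move=> x _; rewrite /truncated_poly horner0 add0r (bigD1_seq b) //= eqxx hornerXn.
by rewrite big1 ?addr0 // => c /negbTE ->; rewrite horner0 mulr0.
Qed.

Lemma spline_span d s tau f : breakpoints tau -> spline d s tau f ->
  bspline_span d s tau f.
Proof.
move=> tauP [P [Q [[h1 h2 h3] e]]].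
apply: bspline_span_eq e _; apply: bspline_spanD.
  apply: (@bspline_span_eq _ _ _ _ _ (fun x => \sum_(i <- index_iota 0 d.+1) P`_i * x ^+ i)).
    by move=> x _; rewrite (horner_coef_wide _ h1) big_mkord.
  apply: bspline_span_sum => i; rewrite mem_index_iota => /andP[_ hi].
  by apply/bspline_spanZ/bspline_span_Xn.
apply: bspline_span_sum => b hb.
apply: (@bspline_span_eq _ _ _ _ _ (fun x => \sum_(i <- index_iota s.+1 d.+1)
    (Q b)`_i * ((b <= x)%R%:R * (x - b) ^+ i))).
  move=> x _; rewrite (horner_coef_wide _ (h2 b)) mulr_sumr.
  under [RHS]eq_bigr => i _ do rewrite mulrCA.
  rewrite -(big_mkord xpredT (fun i => (b <= x)%R%:R * ((Q b)`_i * (x - b) ^+ i))).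
  have [sd|ds] := leqP s d.
    rewrite (big_cat_nat (n := s.+1)) //= [X in X + _]big_nat_cond big1 ?add0r //.
    by move=> i /andP[hi _]; rewrite h3 // mul0r mulr0.
  rewrite [RHS]big_geq; last by lia.
  rewrite big_nat_cond big1 // => i /andP[hi _]; rewrite h3 ?mul0r ?mulr0 //; lia.
apply: bspline_span_sum => i; rewrite mem_index_iota => /andP[si hi].
by apply/bspline_spanZ/bspline_span_trunc => //; rewrite si.
Qed.

(** Converse of [spline_span] by counting: the power family [G] lies in the B-spline span, is free,
    and its index type [J] has [nspl d s tau] elements, so [invert_free_family] applies. *)
Lemma spline_Bspl d s tau i : breakpoints tau -> (i < nspl d s tau)%N ->
  spline d s tau (Bspl d s tau i).
Proof.
move=> tauP.
have tau_uniq : uniq tau := lt_sorted_uniq (breakpoints_sorted tauP).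
pose J : finType := ('I_d.+1 + 'I_(size tau) * 'I_(d - s))%type.
pose G (a : J) (x : R) : R := match a with
  | inl e => x ^+ e
  | inr (k, q) => (tau`_k <= x)%R%:R * (x - tau`_k) ^+ (s.+1 + q)
  end.
have cardJ : nspl d s tau = #|J| by rewrite card_sum card_prod !card_ord.
have splineG a : spline d s tau (G a).
  case: a => [e|[k q]]; first by apply: spline_Xn; rewrite -ltnS.
  by apply: spline_trunc => //; [rewrite mem_nth | have := ltn_ord q; lia].
have /choice[M hM] a : exists c : nat -> R, forall x, unit_itv x ->
    G a x = \sum_(i < #|J|) c i * Bspl d s tau i x.
  by rewrite -cardJ; apply: spline_span.
rewrite cardJ => hi.
have [||c hc] := @invert_free_family R (@unit_itv R) J G (fun j => Bspl d s tau j)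
  (fun a j => M a j) _ _ (Ordinal hi).
- exact: hM.
- move=> v hv.
  (* A vanishing combination of the [G a] is a truncated expansion with polynomial part [P] and
     pieces [Q], whose coefficients are the values of [v]. *)
  pose P := \poly_(j < d.+1) (if insub j is Some e then v (inl e) else 0).
  pose Q (k : 'I_(size tau)) := \sum_(q < d - s) v (inr (k, q)) *: 'X^(s.+1 + q).
  have [||P0 Q0] := @truncated_poly_indep R tau 0 P Q.
  + exact: tauP.
  + move=> x /unit_itvE hx; rewrite -[RHS](hv x hx) big_sumType /=; congr (_ + _).
      rewrite horner_poly; apply: eq_bigr => e _; congr (_ * _).
      by rewrite insubT // => hq; congr (v (inl _)); apply: val_inj.
    rewrite [RHS](eq_bigr (fun kq => v (inr (kq.1, kq.2)) * G (inr (kq.1, kq.2)) x));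
      last by case.
    rewrite -(pair_bigA _ (fun k q => v (inr (k, q)) * G (inr (k, q)) x)) /=.
    apply: eq_bigr => k _; rewrite horner_sum mulr_sumr; apply: eq_bigr => q _.
    by rewrite hornerZ hornerXn mulrCA.
  case=> [e|[k q]].
    have := congr1 (fun p : {poly R} => p`_e) P0.
    rewrite coef0 coef_poly ltn_ord insubT // => he <-; congr (v (inl _)).
    exact: val_inj.
  have := congr1 (fun p : {poly R} => p`_(s.+1 + q)) (Q0 k).
  rewrite coef0 coef_sum (bigD1 q) //= coefZ coefXn eqxx mulr1 big1 ?addr0 // => q' ne.
  by rewrite coefZ coefXn eqn_add2l eq_sym (inj_eq val_inj) (negbTE ne) mulr0.
apply: (spline_eq hc).
by apply: spline_sum => a; apply: splineZ.
Qed.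

End PiecewisePolynomials.

(** * Derivatives of splines on [0,1] *)

Section Derivative.
Variable R : realType.
Implicit Types (d s : nat) (tau : seq R) (f : R -> R) (p : {poly R}) (x : R).

(** Properness makes the limit in [deriv01] unique. Points of [0,1] near x are found to the right
    when x <= 1/2 and to the left otherwise, with a step of at most 1/2. *)
Lemma within_itv_proper x : unit_itv x -> ProperFilter (within (@unit_itv R) x^').
Proof.
move=> /unit_itvE /andP[x0 x1]; apply: Build_ProperFilter_ex => A.
rewrite /within /dnbhs /within /= => /nbhs_ballP [e /= e0 he].
pose h := Num.min (e / 2) 2^-1.
have h0 : 0 < h by rewrite lt_min; apply/andP; split; lra.
have he2 : h < e by rewrite gt_min; apply/orP; left; lra.
have h1 : h <= 2^-1 by rewrite ge_min lexx orbT.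
have [xh|hx] := leP x 2^-1.
  exists (x + h); apply: he; rewrite /ball /=.
  - by rewrite opprD addNKr normrN gtr0_norm.
  - by rewrite gt_eqF // ltrDl.
  - by apply/unit_itvE; lra.
exists (x - h); apply: he; rewrite /ball /=.
- by rewrite opprB addrC subrK gtr0_norm.
- by rewrite lt_eqF // ltrBlDr ltrDl.
- by apply/unit_itvE; lra.
Qed.

Lemma cvg_horner_slope p x :
  (y - x)^-1 * (p.[y] - p.[x]) @[y --> x^'] --> p^`().[x].
Proof.
have : root (p - p.[x]%:P) x by rewrite rootE !hornerE subrr.
case/factor_theorem => q hq.
have dp : p^`().[x] = q.[x].
  rewrite -[p](subrK p.[x]%:P) hq derivD derivC addr0 derivM derivB derivX derivC.
  by rewrite subr0 mulr1 !hornerE subrr mulr0 add0r.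
rewrite dp; apply: (@cvg_trans _ (horner q y @[y --> x^'])).
  apply: near_eq_cvg; rewrite /dnbhs near_withinE; apply: nearW => y /= yx.
  rewrite -[p.[y] - p.[x]](_ : (p - p.[x]%:P).[y] = _); last by rewrite !hornerE.
  by rewrite hq hornerM mulrC hornerXsubC mulfK // subr_eq0.
by apply: cvg_within_filter; apply: continuous_horner.
Qed.

(** Away from b the truncation is locally constant. At x = b the double zero of p makes both
    one-sided slopes tend to 0. *)
Lemma cvg_trunc_slope p (b x : R) : p`_0 = 0 -> p`_1 = 0 ->
  (y - x)^-1 * ((b <= y)%R%:R * p.[y - b] - (b <= x)%R%:R * p.[x - b]) @[y --> x^']
    --> (b <= x)%R%:R * p^`().[x - b].
Proof.
move=> p0 p1; case: (ltgtP b x) => [bx|xb|->].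
- rewrite !mul1r.
  have -> : p^`().[x - b] = (p \Po ('X - b%:P))^`().[x].
    by rewrite deriv_comp derivB derivX derivC subr0 mulr1 horner_comp !hornerE.
  set q := p \Po _.
  apply: (@cvg_trans _ ((y - x)^-1 * (q.[y] - q.[x]) @[y --> x^'])); last exact: cvg_horner_slope.
  apply: near_eq_cvg; apply: cvg_within; near=> y.
  have -> : (b <= y)%R by apply/ltW; near: y; exact: lt_nbhsr.
  by rewrite mul1r /q !horner_comp !hornerE.
- rewrite !mul0r; apply: (@cvg_trans _ (0 @[y --> x^'])); last exact: cvg_cst.
  apply: near_eq_cvg; apply: cvg_within; near=> y.
  rewrite [(b <= y)%R]leNgt (_ : y < b) ?mul0r ?subrr ?mulr0 //.
  by near: y; exact: lt_nbhsl.
have hp : p = drop_poly 2 p * 'X^2.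
  rewrite -[LHS](poly_take_drop 2) (_ : take_poly 2 p = 0) ?add0r //.
  by apply/polyP => i; rewrite coef_take_poly coef0; case: i => [|[|i]].
set q := drop_poly 2 p in hp.
(* With p = 'X^2 q the slope is (y - x)_+ q(y - x). Writing the positive part as (z + |z|) / 2 makes
   it visibly continuous. *)
rewrite !mul1r; have -> : p^`().[x - x] = (x - x + `|x - x|) / 2 * q.[x - x].
  by rewrite subrr normr0 addr0 !mul0r horner_coef0 coef_deriv p1 mul0rn.
apply: (@cvg_trans _ ((y - x + `|y - x|) / 2 * q.[y - x] @[y --> x^'])).
  apply: near_eq_cvg; rewrite /dnbhs near_withinE; apply: nearW => y /= yx.
  have yx0 : y - x != 0 by rewrite subr_eq0.
  rewrite [x - x]subrr [p.[0]]horner_coef0 p0 subr0 hp !hornerE /=.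
  have [xy|yx'] := leP x y.
    by rewrite ger0_norm ?subr_ge0 //= mulr1n; field.
  by rewrite ltr0_norm ?subr_lt0 // subrr mulr0n !mul0r mulr0 !mul0r.
apply: cvg_within_filter.
have sub_cvg : y - x @[y --> x] --> x - x by apply: cvgB; [exact: cvg_id|exact: cvg_cst].
apply: cvgM; last by apply: cvg_comp sub_cvg _; exact: continuous_horner.
apply: cvgMl; apply: cvgD => //; exact: cvg_norm.
Unshelve. all: by end_near.
Qed.

Lemma cvg_truncated_poly_slope d s tau P Q x : (0 < s)%N -> spline_data d s P Q ->
  (y - x)^-1 * (truncated_poly tau P Q y - truncated_poly tau P Q x) @[y --> x^']
    --> truncated_poly tau P^`() (fun b => (Q b)^`()) x.
Proof.
move=> s0 [_ _ Q0].
have -> : (fun y => (y - x)^-1 * (truncated_poly tau P Q y - truncated_poly tau P Q x)) =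
  (fun y => (y - x)^-1 * (P.[y] - P.[x]) + \sum_(b <- tau)
   ((y - x)^-1 * ((b <= y)%R%:R * (Q b).[y - b] - (b <= x)%R%:R * (Q b).[x - b]))).
  by apply/funext => y; rewrite /truncated_poly opprD addrACA mulrDr -sumrB mulr_sumr.
apply: cvgD; first exact: cvg_horner_slope.
apply: (cvg_big add_continuous) => b _.
by apply: cvg_trunc_slope; exact: Q0.
Qed.

Lemma cvg_spline_slope d s tau f P Q x : (0 < s)%N -> spline_data d s P Q ->
  (forall y, unit_itv y -> f y = truncated_poly tau P Q y) -> unit_itv x ->
  (y - x)^-1 * (f y - f x) @[y --> within (@unit_itv R) x^']
    --> truncated_poly tau P^`() (fun b => (Q b)^`()) x.
Proof.
move=> s0 hPQ fE hx.
apply: (@cvg_trans _ ((y - x)^-1 * (truncated_poly tau P Q y - truncated_poly tau P Q x)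
    @[y --> within (@unit_itv R) x^'])); last first.
  by apply: cvg_within_filter; exact: cvg_truncated_poly_slope s0 hPQ.
apply: near_eq_cvg; rewrite near_withinE; apply: nearW => y /= hy.
by rewrite !fE.
Qed.

Lemma deriv01_splineE d s tau f P Q x : (0 < s)%N -> spline_data d s P Q ->
  (forall y, unit_itv y -> f y = truncated_poly tau P Q y) -> unit_itv x ->
  deriv01 f x = truncated_poly tau P^`() (fun b => (Q b)^`()) x.
Proof.
move=> s0 hPQ fE hx; have := within_itv_proper hx => ?.
by apply: cvg_lim => //; exact: cvg_spline_slope s0 hPQ fE hx.
Qed.

Lemma spline_deriv01 d s tau f : spline d.+1 s.+1 tau f -> spline d s tau (deriv01 f).
Proof.
move=> [P [Q [hPQ e]]]; exists P^`(), (fun b => (Q b)^`()); split; last first.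
  by move=> x hx; exact: (deriv01_splineE (ltn0Sn s) hPQ e hx).
have size_deriv (p : {poly R}) : (size p <= d.+2)%N -> (size p^`() <= d.+1)%N.
  by move=> hp; apply: (leq_trans (size_poly _ _)); rewrite -subn1 leq_subLR.
case: hPQ => h1 h2 h3; split=> [|b|b j js]; [exact: size_deriv|exact: size_deriv|].
by rewrite coef_deriv h3 ?mul0rn.
Qed.

(** [deriv01] is a [lim], so linearity requires each difference quotient to converge; splines of
    smoothness s > 0 guarantee this. *)
Lemma deriv01_sum d s tau (n : nat) (c : nat -> R) (g : nat -> R -> R) f x :
  (0 < s)%N -> (forall i, (i < n)%N -> spline d s tau (g i)) ->
  (forall y, unit_itv y -> f y = \sum_(i < n) c i * g i y) -> unit_itv x ->
  deriv01 f x = \sum_(i < n) c i * deriv01 (g i) x.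
Proof.
move=> s0 hg hf hx; have := within_itv_proper hx => ?.
apply: cvg_lim => //.
have cvg_g i : (i < n)%N ->
    (y - x)^-1 * (g i y - g i x) @[y --> within (@unit_itv R) x^'] --> deriv01 (g i) x.
  move=> /hg [P [Q [hPQ e]]]; rewrite (deriv01_splineE s0 hPQ e hx).
  exact: cvg_spline_slope s0 hPQ e hx.
apply: (@cvg_trans _ (\sum_(i < n) c i * ((y - x)^-1 * (g i y - g i x))
    @[y --> within (@unit_itv R) x^'])).
  apply: near_eq_cvg; rewrite near_withinE; apply: nearW => y /= hy.
  rewrite !hf // -sumrB [RHS]mulr_sumr; apply: eq_bigr => i _.
  by rewrite -mulrBr mulrCA.
apply: (cvg_big add_continuous) => i _; apply: cvgMr.
exact: cvg_g.
Qed.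

End Derivative.

(** * Operations on splines and dyadic refinement *)

Section SplineOperations.
Variable R : realType.
Implicit Types (d s : nat) (tau : seq R) (f : R -> R).

Lemma spline_weaken d s s' tau f : (s' <= s)%N -> spline d s tau f -> spline d s' tau f.
Proof.
move=> ss [P [Q [[h1 h2 h3] e]]]; exists P, Q; split => //; split => // b j js.
by rewrite h3 ?(leq_trans js).
Qed.

Lemma spline_refine d s tau tau' f : uniq tau -> uniq tau' -> {subset tau <= tau'} ->
  spline d s tau f -> spline d s tau' f.
Proof.
move=> u u' sub [P [Q [[h1 h2 h3] e]]].
exists P, (fun b => if b \in tau then Q b else 0); split.
  by split=> // [b|b j js]; case: ifP; rewrite ?size_poly0 ?coef0 ?h3.
move=> x hx; rewrite e // /truncated_poly; congr (_ + _).
rewrite [RHS](bigID (mem tau)) /= [X in _ + X]big1 ?addr0 => [|b /negbTE ->]; last first.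
  by rewrite horner0 mulr0.
rewrite -[RHS]big_filter [RHS](perm_big tau); last first.
  apply: uniq_perm => //; first exact: filter_uniq.
  by move=> b; rewrite mem_filter; apply/andP/idP => [[]//|hb]; split=> //; exact: sub.
by rewrite [LHS]big_seq [RHS]big_seq; apply: eq_bigr => b ->.
Qed.

Lemma spline_mul_linear d s tau f (a : {poly R}) : (size a <= 2)%N ->
  spline d s tau f -> spline d.+1 s tau (fun x => a.[x] * f x).
Proof.
move=> ha [P [Q [[h1 h2 h3] e]]].
(* At each breakpoint the linear factor is re-expanded in powers of x - b; the product keeps the
   vanishing low coefficients of [Q b]. *)
exists (a * P), (fun b => (a \Po ('X + b%:P)) * Q b); split.
  split=> [|b|b j js].
  - by apply: (leq_trans (size_polyMleq _ _)); move: (leq_add ha h1); lia.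
  - apply: (leq_trans (size_polyMleq _ _)).
    have := size_comp_poly_leq a ('X + b%:P); rewrite size_XaddC.
    by have := h2 b; lia.
  - rewrite coefM big1 // => i _; rewrite h3 ?mulr0 //.
    exact: leq_trans (leq_subr _ _) js.
move=> x hx; rewrite e // /truncated_poly hornerM mulrDr mulr_sumr; congr (_ + _).
apply: eq_bigr => b _.
by rewrite hornerM horner_comp hornerD hornerX hornerC subrK mulrCA.
Qed.

Lemma refine_from_path (a : R) tau : path <%R a (rcons tau 1) ->
  path <%R a (rcons (refine_from a tau) 1).
Proof.
elim: tau a => [|b tau IH] a /=.
  by rewrite !andbT => h; apply/andP; split; lra.
by move=> /andP[ab /IH ->]; rewrite andbT; apply/andP; split; lra.
Qed.

Lemma sub_refine_from (a : R) tau : {subset tau <= refine_from a tau}.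
Proof.
elim: tau a => [|b tau IH] a //= c; rewrite !inE => /predU1P[->|/(IH b) ->].
  by rewrite eqxx orbT.
by rewrite !orbT.
Qed.

Lemma level_breakpoints tau l : breakpoints tau -> breakpoints (level tau l).
Proof. by move=> h; elim: l => [|l IH] //=; exact: refine_from_path. Qed.

Lemma breakpoints_uniq tau : breakpoints tau -> uniq tau.
Proof. by move=> /breakpoints_sorted; exact: lt_sorted_uniq. Qed.

Lemma Bspl_level_span d s s' tau l i : breakpoints tau -> (s' <= s)%N ->
  (i < nspl d s (level tau l))%N ->
  spline d s' (level tau l.+1) (Bspl d s (level tau l) i).
Proof.
move=> tauP ss hi; apply: (spline_weaken ss).
apply: (@spline_refine _ _ (level tau l)).
- exact/breakpoints_uniq/level_breakpoints.
- exact/breakpoints_uniq/level_breakpoints.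
- exact: sub_refine_from.
- by apply: spline_Bspl => //; exact: level_breakpoints.
Qed.

Lemma bsplineS (t : seq R) e i x : bspline t e.+1 i x =
  (x - t`_i) / (t`_(i + e.+1) - t`_i) * bspline t e i x +
  (t`_(i + e.+1).+1 - x) / (t`_(i + e.+1).+1 - t`_i.+1) * bspline t e i.+1 x.
Proof. by []. Qed.

(** * B-splines on the first knot span *)

Section Germ.
Variables (d s : nat) (tau : seq R).
Hypotheses (tauP : breakpoints tau) (tau0 : (0 < size tau)%N) (sd : (s < d)%N).

Local Notation t := (open_knots d (d - s) tau).
Local Notation b0 := (tau`_0).

Let b0_itv : 0 < b0 < 1.
Proof. by apply: (breakpoints_itv tauP); rewrite mem_nth. Qed.

Let tSd : t`_d.+1 = b0.
Proof. by rewrite -[d.+1]addn0 -[(d.+1 + 0)%N]addn0 (@open_knots_mid _ _ _ _ 0 0) //; lia. Qed.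

Let span_d x : 0 <= x < b0 -> forall i, bspline t 0 i x = (i == d)%:R.
Proof.
move=> /andP[x0 xb]; have hx : 0 <= x <= 1.
  by rewrite x0 (ltW (lt_trans xb _)) //; case/andP: b0_itv.
have [mu [/andP[dmu mun] h0 mux _ _]] := open_knots_span d (d - s) tauP hx.
suff mu_d : mu = d by move=> i; rewrite h0 mu_d.
apply/eqP; rewrite eqn_leq dmu andbT leqNgt; apply/negP => h.
by move: xb; rewrite ltNge -tSd (le_trans _ mux) // open_knots_mono //; lia.
Qed.

(** In the recursion the first term gains a factor x, because t_i = 0 for i <= d, and the second
    trades one degree for one index. The subtraction truncates at 0; in full degree d the exponent
    is i. *)
Lemma bspline_germ e i : (e <= d)%N -> exists q : {poly R}, forall x, 0 <= x < b0 ->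
  bspline t e i x = x ^+ (i + e - d) * q.[x].
Proof.
elim: e i => [|e IH] i he.
  exists (i == d)%:R%:P => x hx; rewrite span_d // hornerC.
  by case: eqP => [->|_]; rewrite ?mulr0 // addn0 subnn mul1r.
have [q1 h1] := IH i (ltnW he); have [q2 h2] := IH i.+1 (ltnW he).
pose A := (t`_(i + e.+1))^-1.
pose B := (t`_(i + e.+1).+1 - t`_i.+1)^-1.
pose C : {poly R} := (t`_(i + e.+1).+1)%:P - 'X.
have [id_|di] := leqP i d; last first.
  exists 0 => x hx; rewrite horner0 mulr0 (bspline_local (span_d hx)) //.
  by rewrite leqNgt di.
have eq2 x : 0 <= x < b0 -> bspline t e i.+1 x = x ^+ (i + e.+1 - d) * q2.[x].
  by move=> hx; rewrite h2 // addnS addSn.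
have [h|h] := leqP d (i + e)%N.
  exists (A *: q1 + B *: (C * q2)) => x hx.
  rewrite bsplineS h1 // eq2 // (@open_knots_lo _ _ _ _ i) // !subr0 -/A -/B.
  rewrite (_ : (i + e.+1 - d)%N = (i + e - d).+1); last by lia.
  by rewrite /C !(hornerD, hornerN, hornerZ, hornerM, hornerX, hornerC) exprS; ring.
exists (A *: ('X * q1) + B *: (C * q2)) => x hx.
rewrite bsplineS h1 // eq2 // (@open_knots_lo _ _ _ _ i) // !subr0 -/A -/B.
rewrite (_ : (i + e.+1 - d)%N = 0%N); last by lia.
rewrite (_ : (i + e - d)%N = 0%N); last by lia.
by rewrite /C !(hornerD, hornerN, hornerZ, hornerM, hornerX, hornerC) expr0; ring.
Qed.

(** Index d - e is the lowest one alive on the first span, so the first recursion term drops out and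
    each degree adds a factor 1 - x / b0. *)
Lemma bspline_first e x : (e <= d)%N -> 0 <= x < b0 ->
  bspline t e (d - e) x = (1 - x / b0) ^+ e.
Proof.
move=> he hx; elim: e he => [|e IH] he; first by rewrite span_d // subn0 eqxx expr0.
rewrite bsplineS (bspline_local (span_d hx)); last by lia.
rewrite mulr0 add0r (_ : (d - e.+1).+1 = (d - e)%N); last by lia.
rewrite IH; last by lia.
rewrite (_ : (d - e.+1 + e.+1)%N = d); last by lia.
rewrite tSd (@open_knots_lo _ _ _ _ (d - e)) ?leq_subr // subr0 exprS.
congr (_ * _); field.
by case/andP: b0_itv => /lt0r_neq0.
Qed.

Lemma Bspl_partition x : unit_itv x -> \sum_(i < nspl d s tau) Bspl d s tau i x = 1.
Proof.
move=> hx; rewrite -[RHS](_ : 'C(d, d)%:R * (0 - x) ^+ (d - d) = 1); last first.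
  by rewrite binn subnn mul1r.
rewrite -(marsden_coef s tauP) //; apply: eq_bigr => i _.
(* Dual polynomials are monic of degree d, so the top coefficient in Marsden's identity gives the
   partition of unity. *)
suff -> : (dual_poly d s tau 0 i)`_d = 1 by rewrite mul1r.
have -> : dual_poly d s tau 0 i =
   \prod_(0 <= j < d) ('X - (- (0 - t`_(i + j.+1)))%:P).
  by apply: eq_bigr => j _; rewrite polyCN opprK.
have : \prod_(0 <= j < d) ('X - (- (0 - t`_(i + j.+1)))%:P) \is monic by exact: monic_prod_XsubC.
by move/monicP; rewrite lead_coefE size_prod_XsubC size_iota subn0.
Qed.

(** By [bspline_germ], 'X^i divides [P i], so only indices 0 and 1 matter. [P 0] is (1 - 'X / b0)^d,
    and the slope of [P 1] is the opposite of that of [P 0], since the B-splines sum to 1. *)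
Lemma Bspl_germ : exists P : nat -> {poly R},
  [/\ forall i x, 0 <= x < b0 -> Bspl d s tau i x = (P i).[x],
      forall i, (P i)`_0 = (i == 0)%:R &
      forall i, (P i)`_1 = d%:R / b0 * ((i == 1)%:R - (i == 0)%:R)].
Proof.
have /choice[q hq] i := bspline_germ i (leqnn d).
pose P i := 'X^i * q i.
have hP i x : 0 <= x < b0 -> Bspl d s tau i x = (P i).[x].
  by move=> hx; rewrite /Bspl hq // addnK hornerM hornerXn.
have /andP[b0_gt0 b0_lt1] := b0_itv.
have P0 : P 0%N = (1 - b0^-1 *: 'X) ^+ d.
  apply/eqP; rewrite -subr_eq0; apply/eqP; apply: (poly_itv_eq0 b0_gt0) => x hx.
  have := bspline_first (leqnn d) hx; rewrite subnn => B0.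
  rewrite hornerD hornerN -hP // /Bspl B0 horner_exp.
  by rewrite hornerD hornerN hornerZ hornerX hornerC [b0^-1 * x]mulrC subrr.
have Psum : \sum_(i < nspl d s tau) P i = 1.
  apply/eqP; rewrite -subr_eq0; apply/eqP; apply: (poly_itv_eq0 b0_gt0) => x hx.
  have hx1 : unit_itv x.
    by apply/unit_itvE; case/andP: hx => -> /lt_trans/(_ b0_lt1)/ltW.
  rewrite hornerD hornerN hornerC horner_sum -(Bspl_partition hx1).
  by apply/eqP; rewrite subr_eq0; apply/eqP/eq_bigr => i _; rewrite hP.
have P00 : (P 0%N)`_0 = 1.
  by rewrite P0 -horner_coef0 horner_exp !hornerE subr0 expr1n.
have P01 : (P 0%N)`_1 = - (d%:R / b0).
  have -> : (P 0%N)`_1 = (P 0%N)^`().[0] by rewrite horner_coef0 coef_deriv.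
  rewrite P0 deriv_exp derivB derivZ derivX derivC hornerMn hornerM horner_exp !hornerE.
  by rewrite ?mulr0 subr0 expr1n; ring.
exists P; split => // [[|i]|[|[|i]]] //.
- by rewrite coefXnM.
- by rewrite P01 /=; ring.
- have n2 : (1 < nspl d s tau)%N by rewrite /nspl; lia.
  have /(congr1 (fun p : {poly R} => p`_1)) := Psum.
  rewrite coefC coef_sum (bigD1 (Ordinal (ltnW n2))) //= (bigD1 (Ordinal n2)) //= big1 => [|i].
    by rewrite P01 => /eqP; rewrite addr0 addrC subr_eq0 => /eqP ->; ring.
  by case: i => [[|[|i]] hi] //= _; rewrite coefXnM.
- by rewrite coefXnM /=; ring.
Qed.

(** Comparing the coefficients of degree 0 and 1 near 0 forces c_0 = Q_0 and c_1 = Q_0 + Q_1 b0 / d,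
    which regroup into the two edge combinations. *)
Lemma bspline_span_boundary f (Q : {poly R}) e : bspline_span d s tau f -> 0 < e ->
  (forall x, 0 <= x < e -> f x = Q.[x]) ->
  exists c : nat -> R, forall x, unit_itv x ->
    f x = Q`_0 * (Bspl d s tau 0 x + Bspl d s tau 1 x)
        + Q`_1 * (b0 / d%:R * Bspl d s tau 1 x)
        + \sum_(i < nspl d s tau | (2 <= i)%N) c i * Bspl d s tau i x.
Proof.
move=> [c hc] e0 hQ; have [P [hP P0 P1]] := Bspl_germ.
have /andP[b0_gt0 b0_lt1] := b0_itv.
have n2 : (1 < nspl d s tau)%N by rewrite /nspl; lia.
have QE : Q = \sum_(i < nspl d s tau) c i *: P i.
  apply/eqP; rewrite -subr_eq0; apply/eqP.
  apply: (@poly_itv_eq0 _ _ 0 (Num.min e b0)); first by rewrite lt_min e0.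
  move=> x /andP[x0]; rewrite lt_min => /andP[xe xb].
  rewrite hornerD hornerN -hQ ?x0 // hc; last by apply/unit_itvE; rewrite x0 (ltW (lt_trans xb _)).
  rewrite horner_sum; apply/eqP; rewrite subr_eq0; apply/eqP/eq_bigr => i _.
  by rewrite hornerZ hP ?x0.
pose i0 := Ordinal (ltnW n2); pose i1 := Ordinal n2.
have c0 : c 0%N = Q`_0.
  rewrite QE coef_sum (bigD1 i0) //= coefZ P0 mulr1 big1 ?addr0 // => i.
  by rewrite -val_eqE /= coefZ P0 => /negbTE ->; rewrite mulr0.
have c1 : c 1%N = Q`_0 + Q`_1 * (b0 / d%:R).
  have -> : Q`_1 = d%:R / b0 * (c 1%N - c 0%N).
    rewrite QE coef_sum (bigD1 i0) //= (bigD1 i1) //= !coefZ !P1 big1 => [/=|i].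
      by ring.
    by case: i => [[|[|i]] hi] //= _; rewrite coefZ P1 /= subrr !mulr0.
  rewrite -c0; field; rewrite (lt0r_neq0 b0_gt0) pnatr_eq0 /=; lia.
exists c => x hx; rewrite hc // (bigD1 i0) //= (bigD1 i1) //= c0 c1 addrA.
congr (_ + _); first by ring.
by apply: eq_bigl => -[[|[|i]] hi].
Qed.

End Germ.
End SplineOperations.

Local Notation span := Defs.span.

(** * Linear spans *)

Section Span.
Variables (K : pzRingType) (V : lmodType K) (A : set V).

Lemma sub_span : A `<=` span A.
Proof.
move=> v Av; exists 1%N, (fun=> 1), (fun=> v); split => //.
by rewrite big_ord1 scale1r.
Qed.

Lemma span0 : span A 0.
Proof. by exists 0%N, (fun=> 0), (fun=> 0); split=> [[]//|]; rewrite big_ord0. Qed.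

Lemma spanD u v : span A u -> span A v -> span A (u + v).
Proof.
move=> [n [c [a [Aa ->]]]] [m [d [b [Ab ->]]]].
pose pick T (f : 'I_n -> T) (g : 'I_m -> T) (i : 'I_(n + m)) :=
  match fintype.split i with inl j => f j | inr k => g k end.
exists (n + m)%N, (pick _ c d), (pick _ a b); split.
  by move=> i; rewrite /pick; case: (fintype.split i).
rewrite big_split_ord; congr (_ + _); apply: eq_bigr => i _; rewrite /pick.
  by rewrite -[lshift m i]/(unsplit (inl i)) unsplitK.
by rewrite -[rshift n i]/(unsplit (inr i)) unsplitK.
Qed.

Lemma spanZ k v : span A v -> span A (k *: v).
Proof.
move=> [n [c [a [Aa ->]]]]; exists n, (fun i => k * c i), a; split => //.
by rewrite scaler_sumr; apply: eq_bigr => i _; rewrite scalerA.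
Qed.

Lemma span_sum I (r : seq I) (P : pred I) (f : I -> V) :
  (forall i, P i -> span A (f i)) -> span A (\sum_(i <- r | P i) f i).
Proof. by move=> h; apply: big_ind => //; [exact: span0 | exact: spanD]. Qed.

End Span.

(** * Functions on the two-patch domain and passage between levels *)

Section TwoPatchSpaces.
Variables (R : realType) (p r : nat) (tau : seq R).
Variables (F : side -> R -> R -> 'rV[R]_2) (alpha beta : side -> {poly R}).
Hypotheses (hr : (1 <= r <= p - 2)%N) (tauP : breakpoints tau).
Hypotheses (tau_gt0 : (0 < size tau)%N) (hF : two_patch_geometry p r tau F).
Hypotheses (size_alpha : forall S, (size (alpha S) <= 2)%N).
Hypotheses (size_beta : forall S, (size (beta S) <= 2)%N).

Local Notation I := (@unit_itv R).
Local Notation W l := (W p r tau F alpha beta l).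
Local Notation Phi l := (@Phi R p r tau F alpha beta l).

Lemma Omega_point (x : Omega F) : exists S x1 x2, [/\ I x1, I x2 & val x = F S x1 x2].
Proof.
have [[x1 [x2 h]]|[x1 [x2 h]]] := set_valP x.
  by exists sideL, x1, x2.
by exists sideR, x1, x2.
Qed.

Lemma has_pullbacks_inj (phi psi : Omega F -> R) g :
  has_pullbacks phi g -> has_pullbacks psi g -> phi = psi.
Proof.
move=> h1 h2; apply/funext => x; have [S [x1 [x2 [i1 i2 e]]]] := Omega_point x.
by rewrite (h1 S x1 x2) // (h2 S x1 x2).
Qed.

(* The patches meet only along the edge [x1 = 0], so agreement there suffices. *)
Lemma has_pullbacks_exists (g : side -> R -> R -> R) :
  (forall z, I z -> g sideL 0 z = g sideR 0 z) ->
  exists phi : Omega F -> R, has_pullbacks phi g.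
Proof.
move=> gE; case: hF => _ inj edge inter.
have i0 : I 0 by apply/unit_itvE; rewrite lexx ler01.
have cross x1 x2 y1 y2 : I x1 -> I x2 -> I y1 -> I y2 ->
    F sideL x1 x2 = F sideR y1 y2 -> g sideL x1 x2 = g sideR y1 y2.
  move=> a1 a2 b1 b2 e.
  have : (F sideL 0 @` I) (F sideL x1 x2).
    by rewrite -inter; split; [exists x1, x2 | exists y1, y2].
  move=> [z iz ez].
  have [<- <-] := (inj sideL).2 0 z x1 x2 i0 iz a1 a2 ez.
  have ez' : F sideR 0 z = F sideR y1 y2 by rewrite -edge // ez.
  have [<- <-] := (inj sideR).2 0 z y1 y2 i0 iz b1 b2 ez'.
  exact: gE.
have /choice[phi hphi] : forall x : Omega F, exists v, forall S x1 x2,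
    I x1 -> I x2 -> val x = F S x1 x2 -> v = g S x1 x2.
  move=> x; have [S [x1 [x2 [a1 a2 e]]]] := Omega_point x.
  exists (g S x1 x2) => S' y1 y2 b1 b2; rewrite e.
  case: S S' {e} => -[] e.
  - by have [-> ->] := (inj sideL).2 x1 x2 y1 y2 a1 a2 b1 b2 e.
  - exact: cross.
  - by apply/esym/cross.
  - by have [-> ->] := (inj sideR).2 x1 x2 y1 y2 a1 a2 b1 b2 e.
by exists phi => S x1 x2 x a1 a2; apply: hphi.
Qed.

(** Membership in [W l] is read on the parameter squares, where all computations take place; by
    [has_pullbacks_inj] the function [phi] is determined by g. *)
Definition pulled_W l (g : side -> R -> R -> R) : Prop :=
  exists2 phi : Omega F -> R, W l phi & has_pullbacks phi g.

Lemma pulled_W_eq l g g' :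
  (forall S x1 x2, I x1 -> I x2 -> g S x1 x2 = g' S x1 x2) ->
  pulled_W l g' -> pulled_W l g.
Proof.
move=> e [phi Wphi h]; exists phi => // S x1 x2 x a1 a2 ex.
by rewrite e // (h S x1 x2 x).
Qed.

Lemma pulled_WD l g h : pulled_W l g -> pulled_W l h ->
  pulled_W l (fun S x1 x2 => g S x1 x2 + h S x1 x2).
Proof.
move=> [phi W1 h1] [psi W2 h2]; exists (phi + psi); first exact: spanD.
by move=> S x1 x2 x a1 a2 e; rewrite -(h1 S x1 x2 x) // -(h2 S x1 x2 x).
Qed.

Lemma pulled_WZ l k g : pulled_W l g -> pulled_W l (fun S x1 x2 => k * g S x1 x2).
Proof.
move=> [phi W1 h1]; exists (k *: phi); first exact: spanZ.
by move=> S x1 x2 x a1 a2 e; rewrite -(h1 S x1 x2 x).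
Qed.

Lemma pulled_W_sum l J (s : seq J) (P : pred J) (g : J -> side -> R -> R -> R) :
  (forall j, P j -> pulled_W l (g j)) ->
  pulled_W l (fun S x1 x2 => \sum_(j <- s | P j) g j S x1 x2).
Proof.
move=> hg; elim: s => [|j s IH].
  exists 0; first exact: span0.
  by move=> S x1 x2 x _ _ _; rewrite big_nil.
have [Pj|nPj] := boolP (P j).
  by apply: pulled_W_eq (pulled_WD (hg j Pj) IH) => S x1 x2 _ _; rewrite big_cons Pj.
by apply: pulled_W_eq IH => S x1 x2 _ _; rewrite big_cons (negbTE nPj).
Qed.

Lemma level_size l : (0 < size (level tau l))%N.
Proof. by case: l => [|l] //=; case: (level tau l). Qed.

Lemma Bspl_at0 d s t i : breakpoints t -> (0 < size t)%N -> (s < d)%N ->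
  Bspl d s t i 0 = (i == 0)%:R :> R.
Proof.
move=> tP t0 sd; have [P [hP P0 _]] := Bspl_germ tP t0 sd.
rewrite hP ?horner_coef0 // lexx /=.
by have /andP[] := breakpoints_itv tP (mem_nth 0 t0).
Qed.

Lemma pulled_W_gen l g : (forall z, I z -> g sideL 0 z = g sideR 0 z) ->
  (forall phi, has_pullbacks phi g -> Phi l phi) -> pulled_W l g.
Proof.
move=> gE hg; have [phi hphi] := has_pullbacks_exists gE.
by exists phi => //; apply/sub_span/hg.
Qed.

Lemma pulled_W_patch l S i j : (2 <= i < nspl p r (level tau l))%N ->
  (j < nspl p r (level tau l))%N -> pulled_W l (pull_patch p r tau l S i j).
Proof.
move=> hi hj; apply: pulled_W_gen => [z iz|phi h].
  rewrite /pull_patch Bspl_at0 ?mul0r; [|exact: level_breakpoints|exact: level_size|lia].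
  by rewrite (_ : (i == 0%N) = false) ?mul0r ?if_same //; lia.
by case: S h => h; [left; left; left|left; left; right]; exists i, j.
Qed.

Lemma pulled_W_Gamma0 l i : (i < nspl p r.+1 (level tau l))%N ->
  pulled_W l (pull_Gamma0 p r tau beta l i).
Proof.
move=> hi; apply: pulled_W_gen => [z iz|phi h].
  (* At x1 = 0 the first B-spline is 1 and the second is 0, so the only side-dependent term, the one
     with [beta S], disappears. *)
  rewrite /pull_Gamma0 !Bspl_at0; try exact: level_breakpoints; try exact: level_size; try lia.
  by rewrite /= !mulr0.
by left; right; exists i.
Qed.

Lemma pulled_W_Gamma1 l i : (i < nspl p.-1 r (level tau l))%N ->
  pulled_W l (pull_Gamma1 p r tau alpha l i).
Proof.
move=> hi; apply: pulled_W_gen => [z iz|phi h].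
  rewrite /pull_Gamma1 !Bspl_at0; try exact: level_breakpoints; try exact: level_size; try lia.
  by rewrite /= !mulr0.
by right; exists i.
Qed.

(** Each patch function is supported on one side only, so [f sideL] and [f sideR] can be expanded
    independently. *)
Lemma pulled_W_inner l m (f : side -> R -> R) : (2 <= m < nspl p r (level tau l))%N ->
  (forall S, spline p r (level tau l) (f S)) ->
  pulled_W l (fun S x1 x2 => Bspl p r (level tau l) m x1 * f S x2).
Proof.
move=> hm hf; have tP := level_breakpoints l tauP.
have [cL hL] := spline_span tP (hf sideL); have [cR hR] := spline_span tP (hf sideR).
pose n := nspl p r (level tau l).
apply: (@pulled_W_eq _ _ (fun S x1 x2 =>
   \sum_(j < n) cL j * pull_patch p r tau l sideL m j S x1 x2
 + \sum_(j < n) cR j * pull_patch p r tau l sideR m j S x1 x2)).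
  move=> [] x1 x2 a1 a2; rewrite /pull_patch /=.
    rewrite [X in _ + X]big1 => [|j _]; last by rewrite mulr0.
    by rewrite addr0 hL // mulr_sumr; apply: eq_bigr => j _; rewrite mulrCA.
  rewrite [X in X + _]big1 => [|j _]; last by rewrite mulr0.
  by rewrite add0r hR // mulr_sumr; apply: eq_bigr => j _; rewrite mulrCA.
by apply: pulled_WD; apply: pulled_W_sum => j _; apply: pulled_WZ; apply: pulled_W_patch.
Qed.

Lemma pulled_W_tail l (c : nat -> R) (f : side -> R -> R) :
  (forall S, spline p r (level tau l) (f S)) ->
  pulled_W l (fun S x1 x2 => (\sum_(m < nspl p r (level tau l) | (2 <= m)%N)
    c m * Bspl p r (level tau l) m x1) * f S x2).
Proof.
move=> hf; apply: (@pulled_W_eq _ _ (fun S x1 x2 =>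
  \sum_(m < nspl p r (level tau l) | (2 <= m)%N)
    c m * (Bspl p r (level tau l) m x1 * f S x2))).
  by move=> S x1 x2 _ _; rewrite mulr_suml; apply: eq_bigr => m _; rewrite mulrA.
apply: pulled_W_sum => m hm; apply: pulled_WZ; apply: pulled_W_inner => //.
by rewrite hm ltn_ord.
Qed.

Lemma level_boundary l (u : nat -> R) k0 k1 :
  let t := level tau l in let t' := level tau l.+1 in
  let f x := \sum_(i < nspl p r t) u i * Bspl p r t i x in
  k0 = u 0%N -> k1 = p%:R / t`_0 * (u 1%N - u 0%N) ->
  exists c : nat -> R, forall x, I x ->
    f x = k0 * (Bspl p r t' 0 x + Bspl p r t' 1 x)
        + k1 * (t'`_0 / p%:R * Bspl p r t' 1 x)
        + \sum_(m < nspl p r t' | (2 <= m)%N) c m * Bspl p r t' m x.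
Proof.
move=> t t' f -> ->; have tP : breakpoints t := level_breakpoints l tauP.
have tP' : breakpoints t' := level_breakpoints l.+1 tauP.
have rp : (r < p)%N by lia.
have [P [hP P0 P1]] := Bspl_germ tP (level_size l) rp.
pose Q := \sum_(i < nspl p r t) u i *: P i.
have n2 : (1 < nspl p r t)%N by rewrite /nspl addSn ltnS ltn_addr //; lia.
have Q0 : Q`_0 = u 0%N.
  rewrite coef_sum (bigD1 (Ordinal (ltnW n2))) //= coefZ P0 mulr1 big1 ?addr0 // => i.
  by rewrite -val_eqE /= coefZ P0 => /negbTE ->; rewrite mulr0.
have Q1 : Q`_1 = p%:R / t`_0 * (u 1%N - u 0%N).
  rewrite coef_sum (bigD1 (Ordinal (ltnW n2))) //= (bigD1 (Ordinal n2)) //= !coefZ !P1.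
  rewrite big1 => [/=|i]; first by ring.
  by case: i => [[|[|i]] hi] //= _; rewrite coefZ P1 /= subrr !mulr0.
have fspl : bspline_span p r t' f.
  apply: spline_span => //; apply: spline_sum => i; apply: splineZ.
  exact: Bspl_level_span.
have t0 : 0 < t`_0.
  by have /andP[] := breakpoints_itv tP (mem_nth 0 (level_size l)).
have [|c hc] := bspline_span_boundary tP' (level_size l.+1) rp fspl (Q := Q) t0.
  by move=> x hx; rewrite horner_sum; apply: eq_bigr => i _; rewrite hP // hornerZ.
by exists c => x hx; rewrite hc // Q0 Q1.
Qed.

Lemma level_boundary_Bspl l i k0 k1 :
  let t := level tau l in let t' := level tau l.+1 in
  (i < nspl p r t)%N -> k0 = (i == 0%N)%:R ->
  k1 = p%:R / t`_0 * ((i == 1%N)%:R - (i == 0%N)%:R) ->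
  exists c : nat -> R, forall x, I x ->
    Bspl p r t i x = k0 * (Bspl p r t' 0 x + Bspl p r t' 1 x)
        + k1 * (t'`_0 / p%:R * Bspl p r t' 1 x)
        + \sum_(m < nspl p r t' | (2 <= m)%N) c m * Bspl p r t' m x.
Proof.
move=> t t' hi e0 e1.
have [||c hc] := @level_boundary l (fun j => (j == i)%:R) k0 k1.
- by rewrite e0 eq_sym.
- by rewrite e1 (eq_sym i 1%N) (eq_sym i 0%N).
exists c => x hx; rewrite -hc // (bigD1 (Ordinal hi)) //= eqxx mul1r big1 ?addr0 // => j.
by rewrite -val_eqE /= => /negbTE ->; rewrite mul0r.
Qed.

Lemma pull_patch_nested l S i j : (2 <= i < nspl p r (level tau l))%N ->
  (j < nspl p r (level tau l))%N -> pulled_W l.+1 (pull_patch p r tau l S i j).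
Proof.
move=> /andP[i2 hi] hj.
(* For i >= 2 value and slope at 0 vanish, so only B-splines of index at least 2 appear on the finer
   level. *)
have [||c hc] := @level_boundary_Bspl l i 0 0 hi.
- by case: i i2 {hi} => [|[|i]].
- by case: i i2 {hi} => [|[|i]] //= _; rewrite subrr mulr0.
have hf S' : spline p r (level tau l.+1)
    (fun x => if same_side S' S then Bspl p r (level tau l) j x else 0).
  by case: (same_side S' S); [exact: Bspl_level_span | exact: spline0].
apply: pulled_W_eq (pulled_W_tail c hf) => S' x1 x2 a1 a2.
by rewrite /pull_patch hc // !mul0r !add0r; case: ifP; rewrite ?mulr0.
Qed.

Lemma pull_Gamma0_nested l i : (i < nspl p r.+1 (level tau l))%N ->
  pulled_W l.+1 (pull_Gamma0 p r tau beta l i).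
Proof.
move=> hi; set t := level tau l; set t' := level tau l.+1.
have tP : breakpoints t := level_breakpoints l tauP.
have tP' : breakpoints t' := level_breakpoints l.+1 tauP.
have n2 : (1 < nspl p r t)%N by rewrite /nspl addSn ltnS ltn_addr //; lia.
have t0 : t`_0 != 0.
  by have /andP[/lt0r_neq0] := breakpoints_itv tP (mem_nth 0 (level_size l)).
have p0 : p%:R != 0 :> R by rewrite pnatr_eq0; lia.
pose A := Bspl p r.+1 t i.
have AS1 : spline p r.+1 t' A by exact: Bspl_level_span.
have AS : spline p r t' A by exact: Bspl_level_span.
have [a ha] := spline_span tP' AS1.
have dA x : I x -> deriv01 A x =
    \sum_(j < nspl p r.+1 t') a j * deriv01 (Bspl p r.+1 t' j) x.
  by move=> hx; apply: (deriv01_sum (ltn0Sn r) _ ha hx) => j hj; exact: spline_Bspl.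
(* The derivative has degree p - 1 and smoothness r; the linear factor [beta S] brings the degree
   back to p. *)
have dAS S : spline p r t' (fun x => (beta S).[x] * deriv01 A x).
  have pE : p = p.-1.+1 by lia.
  rewrite {1}pE; apply: spline_mul_linear => //; apply: spline_deriv01.
  by rewrite -pE.
(* The sum of the first two B-splines has value 1 and slope 0 at 0. *)
have [||c hc] := @level_boundary l (fun j => (j < 2)%N%:R) 1 0 => //.
  by rewrite subrr mulr0.
(* The rescaled second B-spline has value 0 and slope 1 at 0. *)
have [||e he] := @level_boundary l (fun j => (j == 1%N)%:R * (t`_0 / p%:R)) 0 1.
- by rewrite mul0r.
- by rewrite mul1r mul0r subr0; field; rewrite t0 p0.
(* The same coefficients [a] expand [A] and its derivative, so the leading parts assemble into edge
   functions of level l + 1; the two tails carry the splines [A] and [beta S] times the derivative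
   of [A]. *)
apply: (@pulled_W_eq _ _ (fun S x1 x2 =>
   \sum_(j < nspl p r.+1 t') a j * pull_Gamma0 p r tau beta l.+1 j S x1 x2
   + (\sum_(m < nspl p r t' | (2 <= m)%N) c m * Bspl p r t' m x1) * A x2
   + (\sum_(m < nspl p r t' | (2 <= m)%N) e m * Bspl p r t' m x1)
     * ((beta S).[x2] * deriv01 A x2))).
  move=> S x1 x2 a1 a2; rewrite /pull_Gamma0 -/t -/t' -/A.
  have := hc x1 a1; rewrite -/t -/t' (bigD1 (Ordinal (ltnW n2))) //= (bigD1 (Ordinal n2)) //=.
  rewrite big1 => [|[[|[|j]] hj] //= _]; last by rewrite mul0r.
  rewrite !mul1r mul0r !addr0 => ->.
  have := he x1 a1; rewrite -/t -/t' (bigD1 (Ordinal (ltnW n2))) //= (bigD1 (Ordinal n2)) //=.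
  rewrite big1 => [|[[|[|j]] hj] //= _]; last by rewrite !mul0r.
  rewrite !mul1r !mul0r !add0r addr0 => ->.
  have -> : \sum_(j < nspl p r.+1 t') a j * (Bspl p r.+1 t' j x2 *
       (Bspl p r t' 0 x1 + Bspl p r t' 1 x1) + (beta S).[x2] *
       deriv01 (Bspl p r.+1 t' j) x2 * (t'`_0 / p%:R * Bspl p r t' 1 x1))
    = A x2 * (Bspl p r t' 0 x1 + Bspl p r t' 1 x1)
      + (beta S).[x2] * deriv01 A x2 * (t'`_0 / p%:R * Bspl p r t' 1 x1).
    rewrite dA // ha // mulr_sumr !mulr_suml -big_split; apply: eq_bigr => j _ /=.
    by ring.
  by ring.
apply: pulled_WD; last exact: pulled_W_tail.
apply: pulled_WD; last exact: pulled_W_tail.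
by apply: pulled_W_sum => j _; apply: pulled_WZ; apply: pulled_W_Gamma0.
Qed.

Lemma pull_Gamma1_nested l i : (i < nspl p.-1 r (level tau l))%N ->
  pulled_W l.+1 (pull_Gamma1 p r tau alpha l i).
Proof.
move=> hi; set t := level tau l; set t' := level tau l.+1.
have tP : breakpoints t := level_breakpoints l tauP.
have tP' : breakpoints t' := level_breakpoints l.+1 tauP.
have n2 : (1 < nspl p r t)%N by rewrite /nspl addSn ltnS ltn_addr //; lia.
pose A := Bspl p.-1 r t i.
have AS : spline p.-1 r t' A by exact: Bspl_level_span.
have [a ha] := spline_span tP' AS.
have aAS S : spline p r t' (fun x => (alpha S).[x] * A x).
  have pE : p = p.-1.+1 by lia.
  by rewrite {1}pE; apply: spline_mul_linear.
(* [k] is the slope at 0 of the second B-spline of level l, hence that B-spline is k t'_0 / p times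
   its level l + 1 analogue, up to the tail. *)
pose k : R := p%:R / t`_0.
have [||c hc] := @level_boundary_Bspl l 1 0 k n2; rewrite ?subr0 ?mulr1 //.
apply: (@pulled_W_eq _ _ (fun S x1 x2 =>
   \sum_(j < nspl p.-1 r t') (k * (t'`_0 / p%:R) * a j) * pull_Gamma1 p r tau alpha l.+1 j S x1 x2
   + (\sum_(m < nspl p r t' | (2 <= m)%N) c m * Bspl p r t' m x1)
     * ((alpha S).[x2] * A x2))).
  move=> S x1 x2 a1 a2; rewrite /pull_Gamma1 -/t -/t' -/A hc // mul0r add0r mulrDr.
  congr (_ + _); last exact: mulrC.
  rewrite ha // mulr_sumr mulr_suml; apply: eq_bigr => j _.
  by rewrite -/t'; ring.
apply: pulled_WD; last exact: pulled_W_tail.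
by apply: pulled_W_sum => j _; apply: pulled_WZ; apply: pulled_W_Gamma1.
Qed.

Lemma W_nested l : W l `<=` W l.+1.
Proof.
move=> _ [n [c [a [Pa ->]]]]; apply: span_sum => i _; apply: spanZ.
(* A generator coincides with any function having the same pullbacks, so it is enough to treat the
   pullbacks. *)
have of_pull g : has_pullbacks (a i) g -> pulled_W l.+1 g -> W l.+1 (a i).
  by move=> h [psi Wpsi hpsi]; rewrite (has_pullbacks_inj h hpsi).
case: (Pa i) => [[[]|]|].
- by move=> [i' [j [hi hj h]]]; apply: (of_pull _ h); apply: pull_patch_nested.
- by move=> [i' [j [hi hj h]]]; apply: (of_pull _ h); apply: pull_patch_nested.
- by move=> [i' hi h]; apply: (of_pull _ h); apply: pull_Gamma0_nested.
- by move=> [i' hi h]; apply: (of_pull _ h); apply: pull_Gamma1_nested.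
Qed.

End TwoPatchSpaces.

Theorem proposition2 (R : realType) (k p r : nat) (tau : seq R)
    (F : side -> R -> R -> 'rV[R]_2) (alpha beta : side -> {poly R}) (N : nat)
    (hk : (0 < k)%N) (hp : (3 <= p)%N) (hr : (1 <= r <= p - 2)%N)
    (htau_size : size tau = k) (htau : breakpoints tau)
    (hF : two_patch_geometry p r tau F)
    (hG1 : analysis_suitable_G1 F)
    (hab : normalized_gluing_data F alpha beta) :
  forall l : nat, (l.+1 < N)%N ->
    W p r tau F alpha beta l `<=` W p r tau F alpha beta l.+1.
Proof.
move=> l _; case: hab => [[sizes _ _ _] _].
by apply: W_nested => // [|S|S]; [rewrite htau_size | case: (sizes S)..].
Qed.
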